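(* Let $\mathcal H_1,\mathcal H_2$ be Hilbert spaces, $A$ a self-adjoint operator in $\mathcal H_1$ bounded from below, $B$ a densely defined closable operator from $\mathcal H_2$ to $\mathcal H_1$, and $D$ a self-adjoint operator in $\mathcal H_2$ bounded from above; let $\mathfrak a$, $\mathfrak d$ be the closed quadratic forms associated with $A$, $D$. Assume that $\mathrm{dom}(\mathfrak a)\subset\mathrm{dom}(B^* )$ and that either (I) $\mathrm{dom}(B)\subset\mathrm{dom}(D)$ and $\mathrm{dom}(B)$ is a core for $D$, or (II) $\mathrm{dom}(\mathfrak d)\subset\mathrm{dom}(B)$. Let $\mathcal M$ be the closure of $\mathcal M_0=\begin{pmatrix}A&B\\-B^*&D\end{pmatrix}$ with $\mathrm{dom}(\mathcal M_0)=(\mathrm{dom}(A)\cap\mathrm{dom}(B^* ))\times(\mathrm{dom}(B)\cap\mathrm{dom}(D))$ in $\mathcal H_1\oplus\mathcal H_2$. Let $a\in\mathbb R$, $b\ge0$ be such that $\|B^*x\|^2\le a\|x\|^2+b\,\mathfrak a[x]$ for all $x\in\mathrm{dom}(\mathfrak a)$, and let the set $\mathbb B\subset\mathbb C$ and condition (A) be defined (in terms of $a,b$) as in the context. Then $\sigma(\mathcal M)\subset\mathbb B$. In particular, if condition (A) is satisfied, then $\sigma(\mathcal M)\subset\mathbb R$.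
   Context: Hilbert spaces are non-zero and complex. $\mathfrak a$ has domain $\mathrm{dom}(|A|^{1/2})$ and $\mathfrak d$ has domain $\mathrm{dom}(|D|^{1/2})$; $\mathfrak a[x]=\mathfrak a[x,x]$. Under the stated assumptions $\mathcal M_0$ is closable, and such $a,b$ exist (and satisfy $a+b\min\sigma(A)\ge0$). Write $(t)_+=\max\{t,0\}$, $\alpha_-=\min\sigma(A)$, $\delta_+=\max\sigma(D)$, and $\delta_-=\min\sigma(D)$ if $D$ is bounded, $\delta_-=-\infty$ otherwise. Consider (A1) $b\delta_++b^2+a\le0$ and $b>0$; (A2) $\frac{\alpha_--\delta_+}2\ge b+\sqrt{(b\delta_++b^2+a)_+}$. Condition (A) means that (A1) or (A2) holds. Set $\mu=\delta_++b+\sqrt{(b\delta_++b^2+a)_+}$; $\xi_1=\alpha_--\max\{\frac b2,\sqrt{b\alpha_-+a}\}$; $\xi_2=\frac{\alpha_-+\delta_-}2$ if $D$ is bounded and $\xi_2=-\infty$ otherwise; $\xi_-=\max\{\xi_1,\xi_2\}$; $\mu_-=\min\{\alpha_-,\delta_-\}$; $$\mu_+=\begin{cases}-\frac ab&\text{if (A1) holds but (A2) does not},\\ \alpha_--b-\sqrt{(b\delta_++b^2+a)_+}&\text{if (A2) holds but (A1) does not},\\ \max\{-\frac ab,\alpha_--b\}&\text{if (A1) and (A2) hold};\end{cases}$$ $$\eta=\sqrt{\Bigl(b\delta_++b^2+a-\bigl(\bigl(\tfrac{\alpha_--\delta_+}2-b\bigr)_+\bigr)^2\Bigr)_+};\qquad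 \mathbb B_{\rm nr}=\{z\in\mathbb C:\xi_-\le\operatorname{Re}z\le\mu,\ |\operatorname{Im}z|\le\eta\};$$ $$\mathbb B=\begin{cases}[\mu_-,\mu]\cup[\mu_+,\infty)&\text{if (A) holds and $D$ is bounded},\\(-\infty,\mu]\cup[\mu_+,\infty)&\text{if (A) holds and $D$ is unbounded},\\ [\mu_-,\infty)\cup\mathbb B_{\rm nr}&\text{if (A) fails and $D$ is bounded},\\ \mathbb R\cup\mathbb B_{\rm nr}&\text{if (A) fails and $D$ is unbounded}.\end{cases}$$ *)

(* Defs.v *)
From HB Require Import structures.
From mathcomp Require Import all_boot all_order all_algebra.
From mathcomp Require Import sesquilinear complex.
From mathcomp Require Import all_classical all_reals all_analysis.

Set Implicit Arguments.
Unset Strict Implicit.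
Unset Printing Implicit Defensive.

Import Order.TTheory GRing.Theory Num.Theory.
Import numFieldNormedType.Exports.

Local Open Scope classical_set_scope.
Local Open Scope complex_scope.
Local Open Scope ring_scope.

HB.mixin Record CompleteNormedModule_isHilbert (R : realType) H
    of CompleteNormedModule R[i] H := {
  hdot : {dot H for (@Num.conj R[i])} ;
  hdotE : forall x : H, `|x| ^+ 2 = hdot x x
}.

#[short(type="hilbertType")]
HB.structure Definition Hilbert (R : realType) :=
  {H of CompleteNormedModule R[i] H & CompleteNormedModule_isHilbert R H}.

(* Linear in the first argument, conjugate-linear in the second. *)
Definition inner (R : realType) (H : hilbertType R) (x y : H) : R[i] :=
  @hdot R H x y.

(* An (unbounded) operator from H to K is represented by its graph, a subset
   of H * K; the pair (x, y) is in T when x is in dom T and T x = y. *)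
Section Graphs.
Context (R : realType).

Section Operators.
Context (H K : normedModType R[i]).
Implicit Types (T : set (H * K)) (E : set H).

Definition dom T : set H := [set x | exists y, T (x, y)].

Definition functional_graph T :=
  forall x y z, T (x, y) -> T (x, z) -> y = z.

Definition is_operator T := submod_closed [in T] /\ functional_graph T.

Definition densely_defined T := dense (dom T).

Definition closable T := functional_graph (closure T).

Definition restrict_op T E : set (H * K) := [set p | T p /\ E p.1].

Definition is_core E T := E `<=` dom T /\ closure (restrict_op T E) = closure T.

Definition bounded_op T :=
  exists C : R, forall x y, T (x, y) -> `|y| <= C%:C * `|x|.

End Operators.

Definition comp_op (H K L : normedModType R[i])
    (S : set (K * L)) (T : set (H * K)) : set (H * L) :=
  [set p | exists y, T (p.1, y) /\ S (y, p.2)].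

(* T - z has an everywhere defined bounded inverse; (x, y + z *: x) is in T
   exactly when x is in dom T and (T - z) x = y. *)
Definition resolvent_set (H : normedModType R[i]) (T : set (H * H)) : set R[i] :=
  [set z | (forall y, exists! x, T (x, y + z *: x)) /\
           exists C : R, forall x y, T (x, y + z *: x) -> `|x| <= C%:C * `|y|].

Definition spectrum (H : normedModType R[i]) (T : set (H * H)) : set R[i] :=
  ~` resolvent_set T.

Section Hilbert.
Context (H K : hilbertType R).

(* When T is densely defined this is the graph of the adjoint operator. *)
Definition adjoint (T : set (H * K)) : set (K * H) :=
  [set p | forall x y, T (x, y) -> inner y p.1 = inner x p.2].

Implicit Types T S P : set (H * H).

Definition form_bounded_below T :=
  exists m : R, forall x y, T (x, y) -> m%:C * `|x| ^+ 2 <= inner y x.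

Definition form_bounded_above T :=
  exists m : R, forall x y, T (x, y) -> inner y x <= m%:C * `|x| ^+ 2.

Definition nonneg_op T := forall x y, T (x, y) -> 0 <= inner y x.

End Hilbert.

Section SelfAdjoint.
Context (H : hilbertType R).
Implicit Types T S P : set (H * H).

Definition selfadjoint T :=
  [/\ is_operator T, densely_defined T & adjoint T = T].

(* The nonnegative self-adjoint square root, which exists and is unique when P
   is self-adjoint and nonnegative. *)
Definition op_sqrt P : set (H * H) :=
  xget set0 [set S | [/\ selfadjoint S, nonneg_op S & comp_op S S = P]].

Definition op_abs T : set (H * H) := op_sqrt (comp_op (adjoint T) T).

End SelfAdjoint.

(* A sesquilinear form; values of fval outside fdom are irrelevant. *)
Record qform (H : hilbertType R) := QForm {
  fdom : set H ;
  fval : H -> H -> R[i]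
}.

Section Forms.
Context (H : hilbertType R).
Implicit Types (q : qform H) (T : set (H * H)).

Definition quad q (x : H) : R[i] := fval q x x.

Definition hermitian_qform q :=
  [/\ submod_closed [in fdom q],
      forall (c : R[i]) x y z, fdom q x -> fdom q y -> fdom q z ->
        fval q (c *: x + y) z = c * fval q x z + fval q y z
    & forall x y, fdom q x -> fdom q y -> fval q y x = (fval q x y)^*].

Definition semibounded_form q :=
  (exists m : R, forall x, fdom q x -> m%:C * `|x| ^+ 2 <= quad q x) \/
  (exists m : R, forall x, fdom q x -> quad q x <= m%:C * `|x| ^+ 2).

(* Closedness in the sense of Kato; it is insensitive to the sign of q, hence
   applies both to forms bounded from below and to forms bounded from above. *)
Definition closed_form q :=
  forall (u : nat -> H) (x : H),
    (forall n, fdom q (u n)) ->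
    u @ \oo --> x ->
    (forall e : R, 0 < e -> exists N : nat, forall n m : nat,
        (N <= n)%N -> (N <= m)%N -> `|quad q (u n - u m)| < e%:C) ->
    fdom q x /\
    (forall e : R, 0 < e -> exists N : nat, forall n : nat,
        (N <= n)%N -> `|quad q (u n - x)| < e%:C).

(* q is the closed form associated with the semibounded self-adjoint operator
   T: its domain is dom(|T|^{1/2}) and q[x, y] = <T x, y> for x in dom T. *)
Definition associated_form T q :=
  [/\ hermitian_qform q, semibounded_form q, closed_form q,
      fdom q = dom (op_sqrt (op_abs T))
    & forall x y, T (x, y) ->
        fdom q x /\ forall z, fdom q z -> fval q x z = inner y z].

End Forms.

(* H1 * H2 carries the maximum norm of the library. It is equivalent to the
   Hilbert norm of the orthogonal sum, so that the closure of an operator and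
   the spectrum are the same for both norms. *)
Definition block_op (H1 H2 : hilbertType R)
    (A : set (H1 * H1)) (B : set (H2 * H1)) (D : set (H2 * H2)) :
    set ((H1 * H2) * (H1 * H2)) :=
  [set p | exists Ax By B'x Dy,
    [/\ A (p.1.1, Ax), B (p.1.2, By), adjoint B (p.1.1, B'x), D (p.1.2, Dy)
      & p.2 = (Ax + By, - B'x + Dy)]].

(* The least and greatest elements of E, default values when there are none.
   They exist for the real spectra of A and D below when A is self-adjoint and
   bounded from below and D is self-adjoint and bounded from above. For D
   bounded, its spectrum has a least element as well. *)
Definition set_min (E : set R) : R := get [set m | E m /\ lbound E m].
Definition set_max (E : set R) : R := get [set m | E m /\ ubound E m].

Definition real_spectrum (H : hilbertType R) (T : set (H * H)) : set R :=
  [set t | spectrum T t%:C].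

Section Enclosure.
Context (H1 H2 : hilbertType R) (A : set (H1 * H1)) (D : set (H2 * H2)).
Context (a b : R).

Definition pos_part (t : R) : R := Num.max t 0.

Definition alpha_minus : R := set_min (real_spectrum A).
Definition delta_plus : R := set_max (real_spectrum D).
Definition delta_minus : \bar R :=
  if `[< bounded_op D >] then (set_min (real_spectrum D))%:E else -oo%E.

Let am := alpha_minus.
Let dp := delta_plus.
Let r : R := Num.sqrt (pos_part (b * dp + b ^+ 2 + a)).

Definition condA1 : bool := (b * dp + b ^+ 2 + a <= 0) && (0 < b).
Definition condA2 : bool := b + r <= (am - dp) / 2.
Definition condA : bool := condA1 || condA2.

Definition mu : R := dp + b + r.

Definition xi1 : R := am - Num.max (b / 2) (Num.sqrt (b * am + a)).
Definition xi2 : \bar R :=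
  if `[< bounded_op D >] then ((am + set_min (real_spectrum D)) / 2)%:E
  else -oo%E.
Definition xi_minus : \bar R := Order.max xi1%:E xi2.

Definition mu_minus : \bar R := Order.min am%:E delta_minus.

(* Only meaningful, and only used, under condA. *)
Definition mu_plus : R :=
  if condA1 && ~~ condA2 then - (a / b)
  else if condA2 && ~~ condA1 then am - b - r
  else Num.max (- (a / b)) (am - b).

Definition eta : R :=
  Num.sqrt (pos_part (b * dp + b ^+ 2 + a - pos_part ((am - dp) / 2 - b) ^+ 2)).

Definition B_nr : set R[i] :=
  [set z | [/\ (xi_minus <= (complex.Re z)%:E)%E, complex.Re z <= mu
             & `|complex.Im z| <= eta]].

Definition BB : set R[i] :=
  if condA then
    if `[< bounded_op D >] then
      real_complex R @`
        ([set t | (mu_minus <= t%:E)%E /\ t <= mu] `|` [set t | mu_plus <= t])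
    else real_complex R @` ([set t | t <= mu] `|` [set t | mu_plus <= t])
  else
    if `[< bounded_op D >] then
      real_complex R @` [set t | (mu_minus <= t%:E)%E] `|` B_nr
    else range (real_complex R) `|` B_nr.

End Enclosure.
End Graphs.

(* Main.v *)
(* Testing [(M0 - z) (x, y)] against [x] and [y] gives two scalar equations in
   |x|^2, |y|^2, [fa x x], <D y, y> and <B y, x>; together with the bounds of the
   data they force [z] into [BB] when they hold exactly.  A compactness argument
   turns this, for [z] outside [BB], into a lower bound |v| <= C |(M0 - z) v|.
   The range of [M - z] is then closed.  It is everything because a vector (u, w)
   orthogonal to it satisfies the same scalar equations, after replacing
   <B y, x> by - <B* u, w>: the first component of the adjoint equation puts [u]
   into the form domain of [A], hence into [dom B*], and then either assumption
   on [dom B] puts [w] into [dom D]. *)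
Require Import Defs.
From mathcomp Require Import all_boot all_order all_algebra.
From mathcomp Require Import complex.
From mathcomp Require Import all_classical all_reals all_analysis.
From mathcomp Require Import sesquilinear ring lra.

Set Implicit Arguments.
Unset Strict Implicit.
Unset Printing Implicit Defensive.

Import Order.TTheory GRing.Theory Num.Theory.
Import numFieldNormedType.Exports.

Local Open Scope classical_set_scope.
Local Open Scope complex_scope.
Local Open Scope ring_scope.

(** * Squared moduli and inner products *)

(** Excluding exact solutions of the scalar equations only excludes eigenvalues. Spectrum may also
    come from approximate eigenvectors, which need not converge, and [A] and [D] are unbounded. What
    does converge is the tuple of scalars attached to a vector: once normalized, the equations and
    the form bound on [B*] confine even [<A x, x>] and [<D y, y>] to a box. Hence the entire
    interface between operators and geometry is [nr_relation], a relation between real numbers. A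
    second gap lies between the spectrum, through which [alpha_minus] and [delta_plus] are defined,
    and the quadratic-form bounds that the scalars require. It is bridged by Cauchy-Schwarz for
    shifted forms [T - m], which serves three times: for the bottom of the spectrum, for operators
    with a two-sided form bound, and to carry a lower bound from the operator domain to the form
    domain. Since [H1 * H2] carries the maximum norm, the Hilbert space arguments are stated for a
    Hermitian form [h] on a bare module and then applied to single spaces, form domains and the
    orthogonal sum alike. *)

Definition nsqc (R : realType) (z : R[i]) : R := complex.Re z ^+ 2 + complex.Im z ^+ 2.

Section Complex.
Context (R : realType).
Implicit Types z w : R[i].

Lemma ReD z w : complex.Re (z + w) = complex.Re z + complex.Re w.
Proof. by case: z w => [? ?] []. Qed.
Lemma ImD z w : complex.Im (z + w) = complex.Im z + complex.Im w.
Proof. by case: z w => [? ?] []. Qed.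
Lemma ReN z : complex.Re (- z) = - complex.Re z.
Proof. by case: z. Qed.
Lemma ImN z : complex.Im (- z) = - complex.Im z.
Proof. by case: z. Qed.
Lemma ReM z w : complex.Re (z * w) =
  complex.Re z * complex.Re w - complex.Im z * complex.Im w.
Proof. by case: z w => [? ?] []. Qed.
Lemma ImM z w : complex.Im (z * w) =
  complex.Re z * complex.Im w + complex.Im z * complex.Re w.
Proof. by case: z w => [? ?] []. Qed.
Lemma ReJ z : complex.Re (z^*) = complex.Re z.
Proof. by case: z. Qed.
Lemma ImJ z : complex.Im (z^*) = - complex.Im z.
Proof. by case: z. Qed.
Lemma ReC (t : R) : complex.Re t%:C = t. Proof. by []. Qed.
Lemma ImC (t : R) : complex.Im t%:C = 0. Proof. by []. Qed.
Lemma Re0 : complex.Re (0 : R[i]) = 0. Proof. by []. Qed.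
Lemma Im0 : complex.Im (0 : R[i]) = 0. Proof. by []. Qed.
Definition reimE := (ReD, ImD, ReN, ImN, ReM, ImM, ReJ, ImJ, ReC, ImC, Re0, Im0).

Lemma complex_ext z w :
  complex.Re z = complex.Re w -> complex.Im z = complex.Im w -> z = w.
Proof. by case: z w => [? ?] [? ?] /= -> ->. Qed.

Lemma nsqc_ge0 z : 0 <= nsqc z.
Proof. by rewrite addr_ge0 ?sqr_ge0. Qed.

Lemma nsqcM z w : nsqc (z * w) = nsqc z * nsqc w.
Proof. by rewrite /nsqc !reimE; ring. Qed.

Lemma nsqcD_le z w : nsqc (z + w) <= 2 * (nsqc z + nsqc w).
Proof.
rewrite /nsqc !reimE; set p := complex.Re z; set q := complex.Re w.
set r := complex.Im z; set s := complex.Im w.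
have := sqr_ge0 (p - q); have := sqr_ge0 (r - s); nra.
Qed.

Lemma nsqc_eq0 z : nsqc z <= 0 -> z = 0.
Proof.
rewrite /nsqc => h; apply: complex_ext; rewrite reimE; nra.
Qed.

Lemma invrS_lt (e : R) : 0 < e ->
  exists N : nat, forall n, (N <= n)%N -> n.+1%:R^-1 < e.
Proof.
move=> e0; exists (Num.truncn e^-1) => n Nn.
rewrite invf_plt ?posrE ?ltr0n//.
by apply: lt_le_trans (truncnS_gt _) _; rewrite ler_nat ltnS.
Qed.

End Complex.

Section Inner.
Context (R : realType) (H : hilbertType R).
Implicit Types (x y z : H) (c : R[i]).

Definition nsq x : R := complex.Re (inner x x).

Lemma innerDl x y z : inner (x + y) z = inner x z + inner y z.
Proof. exact: linearDl. Qed.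
Lemma innerBl x y z : inner (x - y) z = inner x z - inner y z.
Proof. exact: linearBl. Qed.
Lemma innerNl x z : inner (- x) z = - inner x z.
Proof. exact: linearNl. Qed.
Lemma innerZl c x z : inner (c *: x) z = c * inner x z.
Proof. exact: linearZl_LR. Qed.
Lemma innerC x y : inner y x = (inner x y)^*.
Proof. by rewrite /inner hermC expr0 mul1r. Qed.
Lemma innerDr x y z : inner x (y + z) = inner x y + inner x z.
Proof. exact: linearDr. Qed.
Lemma innerBr x y z : inner x (y - z) = inner x y - inner x z.
Proof. exact: linearBr. Qed.
Lemma innerNr x y : inner x (- y) = - inner x y.
Proof. exact: linearNr. Qed.
Lemma inner0r x : inner x 0 = 0.
Proof. exact: linear0r. Qed.
Lemma innerZr c x y : inner x (c *: y) = c^* * inner x y.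
Proof. exact: linearZr_LR. Qed.

Lemma nsq_ge0 x : 0 <= nsq x.
Proof.
have := @dnorm_ge0 _ _ (@hdot R H) x.
by rewrite lecE => /andP[].
Qed.

Lemma inner_nsq x : inner x x = (nsq x)%:C.
Proof.
have := @dnorm_ge0 _ _ (@hdot R H) x.
by rewrite lecE => /andP[/eqP h _]; apply: complex_ext.
Qed.

Lemma norm2_nsq x : `|x| ^+ 2 = (nsq x)%:C.
Proof. by rewrite hdotE -inner_nsq. Qed.

Lemma norm_nsq x : `|x| = (Num.sqrt (nsq x))%:C.
Proof.
apply/eqP; rewrite -(@eqrXn2 _ 2)//; last by rewrite ler0c sqrtr_ge0.
by rewrite norm2_nsq -rmorphXn/= sqr_sqrtr// nsq_ge0.
Qed.

Lemma nsq_eq0 x : nsq x <= 0 -> x = 0.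
Proof.
move=> h; apply/eqP; rewrite -normr_eq0 norm_nsq.
by rewrite ler0_sqrtr.
Qed.

Lemma nsqD_le x y : nsq (x + y) <= 2 * (nsq x + nsq y).
Proof.
have := nsq_ge0 (x - y); rewrite /nsq !(innerDl, innerDr, innerNl, innerNr) !reimE.
rewrite (innerC x y) reimE; lra.
Qed.
End Inner.

(** * Hermitian forms and the Riesz representation *)

Section Forms.
Context (R : realType) (E : lmodType R[i]).

Definition lin_subspace (V : set E) :=
  V 0 /\ forall (c : R[i]) x y, V x -> V y -> V (c *: x + y).

Lemma lin_subspaceD V x y : lin_subspace V -> V x -> V y -> V (x + y).
Proof. by move=> [_ h] Vx Vy; rewrite -[x]scale1r; exact: h. Qed.
Lemma lin_subspaceZ V c x : lin_subspace V -> V x -> V (c *: x).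
Proof. by move=> [V0 h] Vx; rewrite -[_ *: _]addr0; exact: h. Qed.
Lemma lin_subspaceN V x : lin_subspace V -> V x -> V (- x).
Proof. by move=> sV Vx; rewrite -scaleN1r; exact: lin_subspaceZ. Qed.
Lemma lin_subspaceB V x y : lin_subspace V -> V x -> V y -> V (x - y).
Proof. by move=> sV Vx Vy; apply: lin_subspaceD => //; exact: lin_subspaceN. Qed.

Definition linear_on (V : set E) (l : E -> R[i]) :=
  forall (c : R[i]) x y, V x -> V y -> l (c *: x + y) = c * l x + l y.

Definition herm_on (V : set E) (h : E -> E -> R[i]) :=
  [/\ lin_subspace V, forall z, V z -> linear_on V (h^~ z)
    & forall x y, V x -> V y -> h y x = (h x y)^*].

(** Completeness is measured by the form itself, so that one Riesz lemma covers a Hilbert space, a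
    closed subspace and the domain of a closed form. *)
Definition qform_complete (V : set E) (h : E -> E -> R[i]) :=
  forall u : nat -> E, (forall n, V (u n)) ->
  (forall e : R, 0 < e -> exists N : nat, forall n m : nat,
     (N <= n)%N -> (N <= m)%N -> complex.Re (h (u n - u m) (u n - u m)) < e) ->
  exists2 x, V x & forall e : R, 0 < e -> exists N : nat, forall n : nat,
     (N <= n)%N -> complex.Re (h (u n - x) (u n - x)) < e.

Section Herm.
Context (V : set E) (h : E -> E -> R[i]) (hh : herm_on V h).
Let Q x : R := complex.Re (h x x).

Lemma herm_linDl c x y z : V x -> V y -> V z ->
  h (c *: x + y) z = c * h x z + h y z.
Proof. by move: hh => [_ l _] Vx Vy Vz; exact: l. Qed.

Lemma herm_linDr c x y z : V x -> V y -> V z ->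
  h z (c *: x + y) = c^* * h z x + h z y.
Proof.
move=> Vx Vy Vz; have [sV _ hC] := hh.
rewrite hC ?herm_linDl//; last by apply: sV.2.
by rewrite rmorphD rmorphM /= -!hC.
Qed.

Lemma herm_diag x : V x -> h x x = (Q x)%:C.
Proof.
move=> Vx; have [_ _ /(_ x x Vx Vx)] := hh.
move=> /(congr1 (@complex.Im R)); rewrite ImJ => e.
apply: complex_ext; rewrite //= ; lra.
Qed.

Lemma herm_quadD c x y : V x -> V y ->
  Q (c *: x + y) = nsqc c * Q x + Q y + 2 * complex.Re (c * h x y).
Proof.
move=> Vx Vy; have [sV _ hC] := hh.
rewrite /Q herm_linDl ?herm_linDr//; try exact: sV.2.
rewrite (hC x y Vx Vy) /nsqc !reimE (herm_diag Vx) !reimE; ring.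
Qed.

Lemma small_bound (c q X Y : R) : 0 < c -> 0 <= q -> 0 <= X -> 0 <= Y ->
  X * (4 * (q + 1)) < c -> Y * (4 * (q + 1)) < c -> 2 * (Y * q + q * X) < c.
Proof. by move=> *; nra. Qed.

(** The discriminant criterion as a complex coefficient [s * w^*] produces it: with [N] the squared
    modulus of [w], both the linear and the quadratic term carry [N]. The choice [s = 1 / Y] gives
    the bound; for [Y = 0], [s = (X + 1) / N] contradicts [N > 0]. *)
Lemma quadratic_nonneg (X N Y : R) : 0 <= X -> 0 <= Y -> 0 <= N ->
  (forall s, 0 <= X - 2 * s * N + s ^+ 2 * N * Y) -> N <= X * Y.
Proof.
move=> X0 Y0 N0 p; have [Ygt|Yle] := ltP 0 Y.
  have := p Y^-1.
  have -> : X - 2 * Y^-1 * N + Y^-1 ^+ 2 * N * Y = (X * Y - N) / Y.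
    by field; rewrite gt_eqF.
  by rewrite pmulr_lge0 ?invr_gt0// subr_ge0.
have Y00 : Y = 0 by lra.
subst Y; rewrite mulr0 leNgt; apply/negP => Ngt.
have := p ((X + 1) / N).
have -> : X - 2 * ((X + 1) / N) * N + ((X + 1) / N) ^+ 2 * N * 0 = - X - 2.
  by field; rewrite gt_eqF.
lra.
Qed.

Hypothesis Q_ge0 : forall x, V x -> 0 <= Q x.

Lemma herm_CS x y : V x -> V y -> nsqc (h x y) <= Q x * Q y.
Proof.
move=> Vx Vy; rewrite mulrC.
apply: quadratic_nonneg; rewrite ?Q_ge0 ?nsqc_ge0// => s.
have [sV _ _] := hh.
have := Q_ge0 (sV.2 ((- s)%:C * (h x y)^*) x y Vx Vy).
rewrite herm_quadD// /nsqc !reimE.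
set X := Q x; set Y := Q y.
set a := complex.Re _; set b := complex.Im _; congr (_ <= _); ring.
Qed.

Hypothesis hcompl : qform_complete V h.

(* Minimizes [Q x - 2 Re (l x)]; the same discriminant argument that proves the
   Cauchy-Schwarz inequality shows that near-minimizers nearly represent [l]. *)
Lemma riesz (l : E -> R[i]) (C : R) : 0 <= C -> linear_on V l ->
  (forall x, V x -> nsqc (l x) <= C * Q x) ->
  exists2 u, V u & forall x, V x -> l x = h x u.
Proof.
move=> C0 ll lC; have [sV _ hC] := hh; have V0 := sV.1.
pose J x := Q x - 2 * complex.Re (l x).
(* Arithmetic-geometric mean: [2 |l x| <= 2 sqrt (C * Q x) <= C + Q x]. *)
have JC x : V x -> - C <= J x.
  move=> Vx; have := lC x Vx; have := Q_ge0 Vx; rewrite /nsqc /J.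
  move: (Q x) (complex.Re (l x)) (complex.Im (l x)) => q r s q0 le.
  have := sqr_ge0 s; have := sqr_ge0 (q - C).
  have [|lt] := leP 0 (q + C - 2 * r); first lra.
  have p1 : 0 < 2 * r - (q + C) by lra.
  have p2 : 0 < 2 * r + (q + C) by lra.
  have := mulr_gt0 p1 p2; nra.
pose S := [set J x | x in V].
have S_inf : has_inf S.
  split; first by exists (J 0), 0.
  by exists (- C) => _ [x Vx <-]; exact: JC.
pose I := inf S.
have IJ x : V x -> I <= J x.
  by move=> Vx; apply: ge_inf; [exact: S_inf.2|exists x].
have /choice[u hu] : forall n : nat, exists x, V x /\ J x < I + n.+1%:R^-1.
  move=> n; have [|_ [x Vx <-] Jx] := @inf_adherent _ S (n.+1%:R^-1) _ S_inf.
    by rewrite invr_gt0 ltr0n.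
  by exists x.
have Vu n : V (u n) by case: (hu n).
have Ju n : J (u n) < I + n.+1%:R^-1 by case: (hu n).
have linD c x y : V x -> V y ->
    J (c *: x + y) = nsqc c * Q x + J y - 2 * complex.Re (c * (l x - h x y)).
  move=> Vx Vy; rewrite /J herm_quadD// ll// !reimE; ring.
(* Parallelogram law: the midpoint [(1/2) d + u m] has [J] at least [I], so
   [Q d <= 2 (J (u n) + J (u m) - 2 I)], which is below [2 (1/(n+1) + 1/(m+1))]; hence [e / 4]. *)
have cauchy (e : R) : 0 < e -> exists N : nat, forall n m : nat,
     (N <= n)%N -> (N <= m)%N -> Q (u n - u m) < e.
  move=> e0; have [N hN] := invrS_lt (e := e / 4) (divr_gt0 e0 (ltr0n _ 4)).
  exists N => n m /hN Nn /hN Nm.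
  have := Ju n; have := Ju m.
  set d := u n - u m; have Vd : V d by exact: lin_subspaceB.
  have ed : 1 *: d + u m = u n by rewrite scale1r subrK.
  have := linD (1/2)%:C _ _ Vd (Vu m).
  have := IJ _ (sV.2 (1/2)%:C _ _ Vd (Vu m)).
  have := linD 1 _ _ Vd (Vu m); rewrite ed.
  rewrite /nsqc !reimE /=.
  move: {IJ Ju hu} I (Q d) (complex.Re (l _)) (complex.Re (h _ _)) (complex.Im (l _))
    (complex.Im (h _ _)) (J (u n)) (J (u m)) (J (_ *: d + u m)).
  move: (n.+1%:R^-1) (m.+1%:R^-1) Nn Nm => t1 t2 Nn Nm i q a1 a2 a3 a4 j1 j2 j3.
  by move=> *; lra.
have [v Vv hv] := hcompl Vu cauchy.
exists v => // x Vx; apply/eqP; rewrite -subr_eq0; apply/eqP; apply: nsqc_eq0.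
have lim n : nsqc (l x - h x v) <= 2 * (n.+1%:R^-1 * Q x + Q x * Q (u n - v)).
  have -> : l x - h x v = (l x - h x (u n)) + (h x (u n - v)).
    have -> : u n - v = (-1) *: v + u n by rewrite scaleN1r addrC.
    rewrite herm_linDr// rmorphN1 /=; ring.
  apply: (le_trans (nsqcD_le _ _)); rewrite ler_pM2l ?ltr0n// lerD//; last first.
    by apply: herm_CS => //; exact: lin_subspaceB.
  apply: quadratic_nonneg; rewrite ?nsqc_ge0 ?Q_ge0 ?invr_ge0 ?ler0n// => s.
  set w := l x - _; have := IJ _ (sV.2 (s%:C * w^*) _ _ Vx (Vu n)).
  rewrite linD// -/w => le; have := le_trans le (lexx _); have := Ju n.
  rewrite /nsqc !reimE; move: (J _) (n.+1%:R^-1) (Q x) => j e q.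
  move: (complex.Re _) (complex.Im _) => p t; lra.
have q0 := Q_ge0 Vx; rewrite leNgt; apply/negP => c0.
have q1 : 0 < 4 * (Q x + 1) by lra.
have d0 : 0 < nsqc (l x - h x v) / (4 * (Q x + 1)) by exact: divr_gt0.
have [N1 h1] := invrS_lt d0; have [N2 h2] := hv _ d0.
have X0 : 0 <= Q (u (maxn N1 N2) - v) by apply: Q_ge0; exact: lin_subspaceB.
have Y0 : 0 <= (maxn N1 N2).+1%:R^-1 :> R by rewrite invr_ge0.
have := h1 _ (leq_maxl N1 N2); have := h2 _ (leq_maxr N1 N2).
rewrite -/(Q _) !(ltr_pdivlMr _ _ q1) => lx ly.
suff : 2 * ((maxn N1 N2).+1%:R^-1 * Q x + Q x * Q (u (maxn N1 N2) - v)) <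
  nsqc (l x - h x v) by rewrite ltNge lim.
exact: small_bound.
Qed.
End Herm.
End Forms.

(** * Hilbert-space topology *)

Section Topology.
Context (R : realType).

Lemma complex_gt0 (e : R[i]) : 0 < e -> exists2 r : R, 0 < r & e = r%:C.
Proof.
case: e => r s; rewrite ltcE /= => /andP[/eqP -> r0].
by exists r.
Qed.

Lemma closure_ball (E : normedModType R[i]) (S : set E) x :
  closure S x <-> forall e : R, 0 < e -> exists2 y, S y & ball x e%:C y.
Proof.
split=> [Sx e e0|h U /nbhs_ballP[e /= /complex_gt0[r r0 ->] eU]].
  have [|y [Sy xy]] := Sx (ball x e%:C); first by apply: nbhsx_ballx; rewrite ltcR.
  by exists y.
by have [y Sy xy] := h _ r0; exists y; split => //; exact: eU.
Qed.

Lemma ball_nsq (H : hilbertType R) (x y : H) (e : R) : 0 < e ->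
  ball x e%:C y <-> nsq (x - y) < e ^+ 2.
Proof.
move=> e0; rewrite -ball_normE /= norm_nsq ltcR.
rewrite -[in X in _ <-> X](@sqr_sqrtr _ (nsq _)) ?nsq_ge0//.
by rewrite ltr_pXn2r ?nnegrE ?sqrtr_ge0 ?ltW.
Qed.

Lemma dense_nsq (H : hilbertType R) (S : set H) : dense S ->
  forall x (e : R), 0 < e -> exists2 y, S y & nsq (x - y) < e.
Proof.
move=> dS x e e0; have s0 : 0 < Num.sqrt e by rewrite sqrtr_gt0.
have : open_nbhs x (ball x (Num.sqrt e)%:C).
  split; first by apply: ball_open; rewrite ltcR.
  by apply: ballxx; rewrite ltcR.
case=> oB Bx; have [|y [xy Sy]] := dS (ball x (Num.sqrt e)%:C) _ oB.
  by exists x.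
by exists y => //; move/ball_nsq : xy => /(_ s0); rewrite sqr_sqrtr// ltW.
Qed.

Lemma closure_graph (H K : hilbertType R) (T : set (H * K)) x y :
  closure T (x, y) <-> forall e : R, 0 < e ->
    exists x' y', [/\ T (x', y'), nsq (x - x') < e & nsq (y - y') < e].
Proof.
split=> [/closure_ball h e e0|h].
  have s0 : 0 < Num.sqrt e by rewrite sqrtr_gt0.
  have [[x' y'] Txy [/= /ball_nsq h1 /ball_nsq h2]] := h _ s0.
  have ee := sqr_sqrtr (ltW e0).
  by exists x', y'; split => //; rewrite -ee; auto.
apply/closure_ball => e e0.
have [x' [y' [Txy h1 h2]]] := h (e ^+ 2) (exprn_gt0 _ e0).
by exists (x', y') => //; split; exact/ball_nsq.
Qed.

Lemma closure_graph2 (H1 H2 : hilbertType R)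
    (T : set ((H1 * H2) * (H1 * H2))) x1 x2 y1 y2 :
  closure T ((x1, x2), (y1, y2)) <-> forall e : R, 0 < e ->
    exists x1' x2' y1' y2', [/\ T ((x1', x2'), (y1', y2')),
      nsq (x1 - x1') < e, nsq (x2 - x2') < e, nsq (y1 - y1') < e
      & nsq (y2 - y2') < e].
Proof.
split=> [/closure_ball h e e0|h].
  have s0 : 0 < Num.sqrt e by rewrite sqrtr_gt0.
  have [[[x1' x2'] [y1' y2']] Txy] := h _ s0.
  case=> -[/= /ball_nsq h1 /ball_nsq h2] [/= /ball_nsq h3 /ball_nsq h4].
  have ee := sqr_sqrtr (ltW e0).
  by exists x1', x2', y1', y2'; split => //; rewrite -ee; auto.
apply/closure_ball => e e0.
have [x1' [x2' [y1' [y2' [Txy h1 h2 h3 h4]]]]] := h (e ^+ 2) (exprn_gt0 _ e0).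
by exists ((x1', x2'), (y1', y2')) => //; split; split; exact/ball_nsq.
Qed.

Lemma cvg_nsq (H : hilbertType R) (u : nat -> H) x :
  (u @ \oo --> x) <->
  (forall e : R, 0 < e -> exists N : nat, forall n, (N <= n)%N -> nsq (u n - x) < e).
Proof.
split=> [/cvg_ballP h e e0|h].
  have s0 : 0 < Num.sqrt e by rewrite sqrtr_gt0.
  have [|N _ hN] := h (Num.sqrt e)%:C; first by rewrite ltcR.
  exists N => n /hN /= /ball_sym/(ball_nsq _ _ s0).
  by rewrite sqr_sqrtr ?ltW.
apply/cvg_ballP => _ /complex_gt0[e e0 ->].
have [N hN] := h _ (exprn_gt0 2 e0).
by exists N => // n /hN ?; apply: ball_sym; exact/ball_nsq.
Qed.

Lemma hilbert_complete (H : hilbertType R) (u : nat -> H) :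
  (forall e : R, 0 < e -> exists N : nat, forall n m,
     (N <= n)%N -> (N <= m)%N -> nsq (u n - u m) < e) ->
  exists x : H, u @ \oo --> x.
Proof.
move=> h; suff c : cauchy (u @ \oo) by exists (limn u); exact: cauchy_cvg.
apply: cauchy_exP.
move=> _ /= /complex_gt0[e e0 ->].
have [N hN] := h _ (exprn_gt0 2 e0).
exists (u N); exists N => // n /= Nn; apply/ball_nsq => //; exact: hN.
Qed.

End Topology.

(** * Two-by-two reduction *)

Section Scalars.
Context (R : realType).
Implicit Types (a b am dp dm p q x y s t u v : R).

Lemma pos_part_ge0 t : 0 <= pos_part t.
Proof. by rewrite /pos_part le_max lexx orbT. Qed.

Lemma pos_part_ge t : t <= pos_part t.
Proof. by rewrite /pos_part le_max lexx. Qed.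

Lemma pos_part_id t : 0 <= t -> pos_part t = t.
Proof. by move=> ?; rewrite /pos_part max_l. Qed.

(* The eigenvalue equation for [z = z1 + i z2] at a vector [(x, y)], tested
   against [x] and [y]: [p] and [q] are the squared norms of [x] and [y], [al]
   and [de] stand for [fa x x] and [<D y, y>], and [b1 + i b2] for [<B y, x>].
   The lower bound [dm] of [D] is only available when [db] holds. *)
Definition nr_relation a b am dp (db : bool) dm (z1 z2 p q al de b1 b2 : R) :=
  [/\ 0 <= p, 0 <= q, am * p <= al, de <= dp * q & (db -> dm * q <= de)] /\
  [/\ 0 <= a * p + b * al, b1 ^+ 2 + b2 ^+ 2 <= (a * p + b * al) * q,
      al + b1 = z1 * p, de - b1 = z1 * q & b2 = z2 * p /\ b2 = z2 * q].

(** Origin of [xi1]: [x - sqrt (a + b x)] increases as soon as the root exceeds [b / 2]. The maximum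
    [c] satisfies [c >= b / 2] and [c^2 >= a + b am], so [s > c] yields
    [b (s - c) <= s^2 - c^2 <= b (x - am)]. *)
Lemma nonreal_real_part_lower a b am x y s : 0 <= b -> s ^+ 2 <= a + b * x ->
  am <= x -> am - Num.max (b / 2) (Num.sqrt (b * am + a)) <= x - s.
Proof.
move=> b0 sx amx; set c := Num.max _ _.
have bc : b / 2 <= c by rewrite le_max lexx.
have ac : b * am + a <= c ^+ 2.
  have [h|h] := leP 0 (b * am + a); last exact: le_trans (ltW h) (sqr_ge0 _).
  have sc : Num.sqrt (b * am + a) <= c by rewrite le_max lexx orbT.
  rewrite -{1}(sqr_sqrtr h) ler_sqr ?nnegrE ?sqrtr_ge0//.
  exact: le_trans (sqrtr_ge0 _) sc.
have [|sc] := leP s c; first lra.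
have [b00|bn] := eqVneq b 0; first by subst b; nra.
have bp : 0 < b by rewrite lt_def bn.
have h1 : (s - c) * b <= (s - c) * (s + c) by apply: ler_wpM2l; lra.
have h2 : b * (s - c) <= b * (x - am) by nra.
by rewrite ler_pM2l// in h2; lra.
Qed.

(** A nonzero imaginary part forces [p = q]. After division by [p], [x = z1 + s] and [y = z1 - s],
    and the form bound reads [s^2 + z2^2 <= a + b x]. Substituting [x = y + 2 s] and completing the
    square gives [(s - b)^2 + z2^2 <= K]; with [s >= (am - dp) / 2] this contradicts both (A1) and
    (A2) and yields the width [eta]. *)
Lemma nr_nonreal a b am dp db dm z1 z2 p q al de b1 b2 :
  let K := b * dp + b ^+ 2 + a in let r := Num.sqrt (pos_part K) in
  0 <= b -> 0 < p + q -> z2 != 0 ->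
  nr_relation a b am dp db dm z1 z2 p q al de b1 b2 ->
  [/\ 0 < K, (am - dp) / 2 < b + r, z1 <= dp + b + r,
      z2 ^+ 2 <= K - pos_part ((am - dp) / 2 - b) ^+ 2
    & am - Num.max (b / 2) (Num.sqrt (b * am + a)) <= z1 /\
      (db -> (am + dm) / 2 <= z1)].
Proof.
move=> K r b0 pq z20 [[p0 q0 amp dpq dmq] [abp bb e1 e2 [e3 e4]]].
have pe : p = q.
  by apply: (mulfI z20); rewrite -e3 e4.
subst q; have {pq p0 q0} p0 : 0 < p by lra.
pose x := al / p; pose y := de / p; pose s := x - z1.
have alE : al = x * p by rewrite divfK// gt_eqF.
have deE : de = y * p by rewrite divfK// gt_eqF.
have amx : am <= x by rewrite ler_pdivlMr.
have ydp : y <= dp by rewrite ler_pdivrMr.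
have dmy : db -> dm <= y by move=> /dmq; rewrite ler_pdivlMr.
have b1E : b1 = - s * p by rewrite /s; lra.
have yE : y = z1 - s.
  by apply: (mulIf (lt0r_neq0 p0)); rewrite -deE; lra.
have main : s ^+ 2 + z2 ^+ 2 <= a + b * x.
  rewrite -(ler_pM2r (exprn_gt0 2 p0)).
  suff -> : (s ^+ 2 + z2 ^+ 2) * p ^+ 2 = b1 ^+ 2 + b2 ^+ 2.
    suff -> : (a + b * x) * p ^+ 2 = (a * p + b * al) * p by [].
    by rewrite alE; ring.
  by rewrite b1E e3; ring.
have z2p : 0 < z2 ^+ 2 by rewrite exprn_even_gt0.
have xE : x = z1 + s by rewrite /s; ring.
have key : (s - b) ^+ 2 + z2 ^+ 2 <= K.
  rewrite /K; have : b * y <= b * dp by exact: ler_wpM2l.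
  by move: main; rewrite xE yE; nra.
have K0 : 0 < K by have := sqr_ge0 (s - b); lra.
have r0 : 0 <= r by exact: sqrtr_ge0.
have rK : r ^+ 2 = K by rewrite sqr_sqrtr pos_part_id ?ltW.
have sr : s - b < r by rewrite ltNge; apply/negP => h; nra.
have sd : (am - dp) / 2 <= s by lra.
split=> //; [lra|lra| |split].
- rewrite /pos_part; case: (leP ((am - dp) / 2 - b) 0) => h.
    by rewrite expr0n /= subr0; have := sqr_ge0 (s - b); lra.
  by nra.
- have -> : z1 = x - s by rewrite /s; ring.
  by apply: nonreal_real_part_lower => //; lra.
- by move=> /dmy; lra.
Qed.

(** Adding the two equations cancels the coupling: [al + de = z1 (p + q)]. *)
Lemma nr_real_lower a b am dp db dm z1 p q al de b1 b2 :
  0 < p + q ->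
  nr_relation a b am dp db dm z1 0 p q al de b1 b2 -> db ->
  Num.min am dm <= z1.
Proof.
move=> pq [[p0 q0 amp dpq dmq] [abp bb e1 e2 _]] /dmq dmq'.
rewrite leNgt lt_min; apply/negP => /andP[h1 h2].
have [pp|pp] := ltP 0 p; nra.
Qed.

(** With [t = - b1] the form bound becomes [t (t - b q) <= (a + b z1) p q]. Above [dp + b] one has
    [t >= (z1 - dp) q > b q], so the left side is positive, while below [- a / b] the right side is
    not. If [q = 0] then [b1 = 0], and [0 <= a p + b al] fails instead. *)
Lemma nr_gap1 a b am dp db dm z1 p q al de b1 b2 :
  0 < p + q -> 0 < b -> b * dp + b ^+ 2 + a <= 0 ->
  nr_relation a b am dp db dm z1 0 p q al de b1 b2 ->
  dp + b < z1 -> z1 < - (a / b) -> False.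
Proof.
move=> pq b0 K0 [[p0 q0 amp dpq dmq] [abp bb e1 e2 _]] h1.
rewrite -mulNr ltr_pdivlMr// => h2.
pose t := - b1; have tq : (z1 - dp) * q <= t by rewrite /t; lra.
have alE : al = z1 * p + t by rewrite /t; lra.
have [qp|q00] := ltP 0 q; last first.
  have qE : q = 0 by lra.
  have b10 : b1 = 0 by subst q; nra.
  have pp : 0 < p by lra.
  by move: abp; rewrite alE /t b10; nra.
have t0 : b * q < t by nra.
have tt : t ^+ 2 <= (a * p + b * (z1 * p + t)) * q.
  by rewrite -alE; apply: le_trans bb; rewrite /t sqrrN lerDl sqr_ge0.
have : (a + z1 * b) * (p * q) <= 0.
  by apply: mulr_le0_ge0; [lra|exact: mulr_ge0].
have : 0 < t * (t - b * q) by apply: mulr_gt0; nra.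
lra.
Qed.

(** Put [u = z1 - dp] and [v = am - z1], both larger than [b + r]. The equations give [t >= u q] and
    [t >= v p], so the inequality [t (t - b q) <= (a + b z1) p q] implies
    [v (u - b) <= r^2 + b (u - b)]. This is incompatible with [v > b + r] and [u - b > r]. *)
Lemma nr_gap2 a b r am dp db dm z1 p q al de b1 b2 :
  0 < p + q -> 0 <= b -> 0 <= r -> b * dp + b ^+ 2 + a <= r ^+ 2 ->
  nr_relation a b am dp db dm z1 0 p q al de b1 b2 ->
  dp + b + r < z1 -> z1 < am - b - r -> False.
Proof.
move=> pq b0 r0 Kr [[p0 q0 amp dpq dmq] [abp bb e1 e2 _]] h1 h2.
pose t := - b1; have tq : (z1 - dp) * q <= t by rewrite /t; lra.
have alE : al = z1 * p + t by rewrite /t; lra.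
have tp : (am - z1) * p <= t by lra.
set u := z1 - dp in tq; set v := am - z1 in tp.
have ub : b + r < u by rewrite /u; lra.
have vb : b + r < v by rewrite /v; lra.
have tt : t ^+ 2 <= (a * p + b * (z1 * p + t)) * q.
  by rewrite -alE; apply: le_trans bb; rewrite /t sqrrN lerDl sqr_ge0.
have aE : a + b * z1 <= r ^+ 2 + b * (u - b) by rewrite /u; lra.
have ht : t * (t - b * q) <= (a + b * z1) * (p * q) by move: tt; lra.
have [qp|q00] := ltP 0 q; last first.
  have qE : q = 0 by lra.
  have b10 : b1 = 0 by subst q; nra.
  have pp : 0 < p by lra.
  by move: tp; rewrite /t b10; nra.
have [pp|p00] := ltP 0 p; last first.
  have pE : p = 0 by lra.
  have bt : b * q < t by nra.
  have : 0 < t * (t - b * q) by apply: mulr_gt0; nra.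
  by move: ht; rewrite pE mul0r mulr0; lra.
have s1 : (u - b) * q <= t - b * q by lra.
have s2 : (v * p) * ((u - b) * q) <= t * (t - b * q).
  by apply: ler_pM => //; apply: mulr_ge0; lra.
have pq0 : 0 < p * q by exact: mulr_gt0.
have s3 : v * (u - b) <= r ^+ 2 + b * (u - b).
  rewrite -(ler_pM2r pq0); apply: le_trans (_ : _ <= (a + b * z1) * (p * q)) _.
    by apply: le_trans ht; move: s2; lra.
  by rewrite ler_pM2r.
have s4 : (b + r) * (u - b) < v * (u - b) by rewrite ltr_pM2r//; lra.
have s5 : r * r <= r * (u - b) by apply: ler_wpM2l; lra.
lra.
Qed.

End Scalars.

Section Enclosure.
Context (R : realType).

Lemma nr_relation_BB (H1 H2 : hilbertType R) (A : set (H1 * H1))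
    (D : set (H2 * H2)) (a b : R) (z : R[i]) (p q al de b1 b2 : R) :
  0 <= b -> 0 < p + q ->
  nr_relation a b (alpha_minus A) (delta_plus D) `[< bounded_op D >]
    (set_min (real_spectrum D)) (complex.Re z) (complex.Im z) p q al de b1 b2 ->
  BB A D a b z.
Proof.
case: z => z1 z2 /= b0 pq rel.
have [z20|z2n] := eqVneq z2 0; last first.
  have [K0 h2 h3 h4 [h5 h6]] := nr_nonreal b0 pq z2n rel.
  have cA1 : ~~ condA1 D a b by rewrite /condA1 leNgt K0.
  have cA2 : ~~ condA2 A D a b by rewrite /condA2 -ltNge.
  have nr : B_nr A D a b (z1 +i* z2).
    split => //=.
      rewrite /xi_minus /xi1 /xi2 ge_max lee_fin h5 /=.
      by case: ifP => [/h6|_]; rewrite ?lee_fin ?leNye.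
    rewrite /eta pos_part_id; last exact: le_trans (sqr_ge0 _) h4.
    by rewrite -sqrtr_sqr; exact: ler_wsqrtr.
  rewrite /BB /condA (negbTE cA1) (negbTE cA2) /=.
  by case: ifP => _; right.
subst z2.
have zE : z1 +i* 0 = z1%:C by [].
have mum : `[< bounded_op D >] -> (mu_minus A D <= z1%:E)%E.
  move=> bD; have := nr_real_lower pq rel bD.
  by rewrite /mu_minus /delta_minus bD -EFin_min lee_fin.
have gap : condA A D a b -> z1 <= mu D a b \/ mu_plus A D a b <= z1.
  move=> cA; have [|h1] := leP z1 (mu D a b); [by left|right].
  rewrite leNgt; apply/negP => h2; move: cA h1 h2.
  rewrite /condA /mu_plus /mu.
  set K := b * _ + _ + _; set r := Num.sqrt _.
  have r0 : 0 <= r by exact: sqrtr_ge0.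
  have Kr : K <= r ^+ 2 by rewrite sqr_sqrtr ?pos_part_ge0// pos_part_ge.
  case c1 : (condA1 D a b); case c2 : (condA2 A D a b) => //= _ h1.
  - move: c1 => /andP[K0 bp].
    (* When (A1) and (A2) both hold, the two gaps share the lower end [dp + b], because [r = 0]; the
       maximum in [mu_plus] then asks for whichever gap contains [z1]. *)
    have r00 : r = 0 by rewrite /r ler0_sqrtr// /pos_part ge_max K0 lexx.
    rewrite lt_max => /orP[h2|h2].
      by apply: (nr_gap1 pq bp K0 rel) => //; lra.
    by apply: (nr_gap2 pq b0 r0 Kr rel) => //; lra.
  - move: c1 => /andP[K0 bp] h2.
    by apply: (nr_gap1 pq bp K0 rel) => //; lra.
  - by move=> h2; apply: (nr_gap2 pq b0 r0 Kr rel) => //; lra.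
rewrite /BB zE; case: ifPn => cA; case: ifPn => bD.
- by exists z1 => //; case: (gap cA) => ?; [left|right] => //; split => //; exact: mum.
- by exists z1 => //; case: (gap cA); [left|right].
- by left; exists z1 => //; exact: mum.
- by left; exists z1.
Qed.

(* Vanishes exactly when [x <= 0]. *)
Let ppen (x : R) := `|x| + x.

Let ppen_ge0 x : 0 <= ppen x.
Proof. by rewrite /ppen; have := ler_norm (- x); rewrite normrN; lra. Qed.

Let ppen_eq0 x : ppen x = 0 -> x <= 0.
Proof. by rewrite /ppen; have := normr_ge0 x; lra. Qed.

Let ppen_le0 x : x <= 0 -> ppen x = 0.
Proof. by move=> x0; rewrite /ppen ler0_norm// addNr. Qed.

Let sum11_le0 (x1 x2 x3 x4 x5 x6 x7 x8 x9 x10 x11 : R) :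
  0 <= x1 -> 0 <= x2 -> 0 <= x3 -> 0 <= x4 -> 0 <= x5 -> 0 <= x6 -> 0 <= x7 ->
  0 <= x8 -> 0 <= x9 -> 0 <= x10 -> 0 <= x11 ->
  x1 + x2 + x3 + x4 + (x5 + x6 + x7 + x8 + x9 + x10 + x11) <= 0 ->
  [/\ [/\ x1 <= 0, x2 <= 0, x3 <= 0 & x4 <= 0],
      [/\ x5 <= 0, x6 <= 0, x7 <= 0 & x8 <= 0]
    & [/\ x9 <= 0, x10 <= 0 & x11 <= 0]].
Proof. by move=> *; do 2!split; lra. Qed.

Let quad_bound (x P b : R) : 0 <= x -> x ^+ 2 <= P + b * x -> 0 <= P ->
  0 <= b -> x <= P + b + 1.
Proof. by move=> *; rewrite leNgt; apply/negP => ?; nra. Qed.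

(** * Uniform violation of the scalar relation *)

Section Gap.
Variables (a b am dp : R) (db : bool) (dm z1 z2 : R).
Hypothesis b0 : 0 <= b.
Hypothesis norel : forall p q al de b1 b2, 0 < p + q ->
  ~ nr_relation a b am dp db dm z1 z2 p q al de b1 b2.

Let err p q al de b1 b2 : R :=
  `|al + b1 - z1 * p| + `|de - b1 - z1 * q| + `|b2 - z2 * p| + `|b2 - z2 * q|.

Let pen p q al de b1 b2 : R :=
  ppen (- p) + ppen (- q) + ppen (am * p - al) + ppen (de - dp * q) +
  (if db then ppen (dm * q - de) else 0) + ppen (- (a * p + b * al)) +
  ppen (b1 ^+ 2 + b2 ^+ 2 - (a * p + b * al) * q).

(** The coordinates are [(p, al, de, b1, b2)]; the normalization eliminates [q] as [1 - p]. *)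
Let F (t : R * (R * (R * (R * R)))) : R :=
  err t.1 (1 - t.1) t.2.1 t.2.2.1 t.2.2.2.1 t.2.2.2.2 +
  pen t.1 (1 - t.1) t.2.1 t.2.2.1 t.2.2.2.1 t.2.2.2.2.

Let F_continuous : continuous F.
Proof.
have cf (U V : topologicalType) : continuous (@fst U V) by move=> t; exact: cvg_fst.
have cs (U V : topologicalType) : continuous (@snd U V) by move=> t; exact: cvg_snd.
have c1 : continuous (fun t : R * (R * (R * (R * R))) => t.1) by exact: cf.
have cc (U V W : topologicalType) (g : V -> W) :
    continuous g -> continuous (fun t : U * V => g t.2).
  by move=> cg t; apply: continuous_comp; [exact: cs|exact: cg].
have c2 : continuous (fun t : R * (R * (R * (R * R))) => t.2.1).
  exact: (cc _ _ _ _ (cf _ _)).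
have c3 : continuous (fun t : R * (R * (R * (R * R))) => t.2.2.1).
  exact: (cc _ _ _ _ (cc _ _ _ _ (cf _ _))).
have c4 : continuous (fun t : R * (R * (R * (R * R))) => t.2.2.2.1).
  exact: (cc _ _ _ _ (cc _ _ _ _ (cc _ _ _ _ (cf _ _)))).
have c5 : continuous (fun t : R * (R * (R * (R * R))) => t.2.2.2.2).
  exact: (cc _ _ _ _ (cc _ _ _ _ (cc _ _ _ _ (cs _ _)))).
have cD (f g : R * (R * (R * (R * R))) -> R) :
    continuous f -> continuous g -> continuous (fun t => f t + g t).
  by move=> hf hg t; apply: cvgD; [exact: hf|exact: hg].
have cM (f g : R * (R * (R * (R * R))) -> R) :
    continuous f -> continuous g -> continuous (fun t => f t * g t).
  by move=> hf hg t; apply: cvgM; [exact: hf|exact: hg].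
have cN (f : R * (R * (R * (R * R))) -> R) :
    continuous f -> continuous (fun t => - f t).
  by move=> hf t; apply: cvgN; exact: hf.
have cA (f : R * (R * (R * (R * R))) -> R) :
    continuous f -> continuous (fun t => `|f t|).
  by move=> hf t; apply: cvg_norm; exact: hf.
have cC (k : R) : continuous (fun _ : R * (R * (R * (R * R))) => k).
  by move=> t; exact: cvg_cst.
have cS (f : R * (R * (R * (R * R))) -> R) :
    continuous f -> continuous (fun t => f t ^+ 2).
  by move=> hf; exact: cM.
rewrite /F /err /pen /ppen.
case: (db); repeat lazymatch goal with
  | |- continuous (fun t => t.1) => exact: c1
  | |- continuous (fun t => t.2.1) => exact: c2
  | |- continuous (fun t => t.2.2.1) => exact: c3
  | |- continuous (fun t => t.2.2.2.1) => exact: c4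
  | |- continuous (fun t => t.2.2.2.2) => exact: c5
  | |- continuous (fun t => @?f t + @?g t) => apply: (cD f g)
  | |- continuous (fun t => @?f t * @?g t) => apply: (cM f g)
  | |- continuous (fun t => - @?f t) => apply: (cN f)
  | |- continuous (fun t => `|@?f t|) => apply: (cA f)
  | |- continuous (fun t => @?f t ^+ 2) => apply: (cS f)
  | |- continuous (fun t => ?k) => exact: (cC k)
  end.
Qed.

(* The constraints and equations are homogeneous, so on the normalized compact
   set [p + q = 1] the total violation [F] attains a positive minimum. *)
Lemma nr_gap : exists2 c : R, 0 < c & forall p q al de b1 b2,
  [/\ 0 <= p, 0 <= q, am * p <= al, de <= dp * q & (db -> dm * q <= de)] ->
  0 <= a * p + b * al -> b1 ^+ 2 + b2 ^+ 2 <= (a * p + b * al) * q ->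
  c * (p + q) <= `|al + b1 - z1 * p| + `|de - b1 - z1 * q| +
                 `|b2 - z2 * p| + `|b2 - z2 * q|.
Proof.
(* Where the residual [err] is at most 1, the first equation gives [|al| <= 1 + |b1| + |z1|]. The
   form bound then becomes [b1^2 <= P + b |b1|], so [|b1| <= P + b + 1], and [C] dominates the
   resulting bounds on all unbounded coordinates. *)
pose P := `|a| + b * (1 + `|z1|).
pose C := 2 + `|z1| + `|z2| + P + b.
have P0 : 0 <= P by rewrite addr_ge0// mulr_ge0// addr_ge0.
have z10 := normr_ge0 z1; have z20 := normr_ge0 z2.
have C2 : 2 <= C.
  by rewrite /C; move: (P) `|z1| `|z2| P0 z10 z20 b0 => *; lra.
have C0 : 0 <= C by exact: le_trans C2.
pose box : set (R * (R * (R * (R * R)))) :=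
  `[0, 1] `*` (`[- C, C] `*` (`[- C, C] `*` (`[- C, C] `*` `[- C, C]))).
have cbox : compact box by do !apply: compact_setX; exact: segment_compact.
have i0 : `[- C, C]%classic 0 by rewrite /= in_itv /= C0 oppr_le0 C0.
have box0 : box !=set0.
  by exists (0, (0, (0, (0, 0)))); do !split=> //; rewrite /= in_itv /= lexx ler01.
have [t0 /set_mem tbox tmin] := compact_EVT_min box0 cbox (continuous_subspaceT F_continuous).
have F0 : 0 < F t0.
  rewrite ltNge; apply/negP => Ft0.
  case: t0 Ft0 {tbox tmin} => p [al [de [b1 b2]]]; rewrite /F /err /pen /=.
  set q := 1 - p; move=> Ft0.
  have pq : 0 < p + q by rewrite /q; lra.
  apply: (norel (al := al) (de := de) (b1 := b1) (b2 := b2) pq).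
  have db0 : 0 <= if db then ppen (dm * q - de) else 0 by case: (db).
  have n (x y : R) : `|x - y| <= 0 -> x = y.
    by rewrite normr_le0 subr_eq0 => /eqP.
  have pb (x y : R) : ppen (x - y) <= 0 -> x <= y.
    move=> h; rewrite -subr_le0; apply: ppen_eq0; apply/eqP.
    by rewrite eq_le h ppen_ge0.
  have pn (x : R) : ppen (- x) <= 0 -> 0 <= x.
    by rewrite -(add0r (- x)) => /pb.
  have [[k1 k2 k3 k4] [k5 k6 k7 k8] [k9 k10 k11]] :=
    sum11_le0 (normr_ge0 _) (normr_ge0 _) (normr_ge0 _) (normr_ge0 _)
      (ppen_ge0 _) (ppen_ge0 _) (ppen_ge0 _) (ppen_ge0 _) db0 (ppen_ge0 _)
      (ppen_ge0 _) Ft0.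
  split; split; rewrite ?(n _ _ k1) ?(n _ _ k2)//.
  - exact: pn k5.
  - exact: pn k6.
  - exact: pb k7.
  - exact: pb k8.
  - by move=> dbT; move: k9; rewrite dbT => /pb.
  - exact: pn k10.
  - exact: pb k11.
  - by split; [exact: n k3|exact: n k4].
have bounded p al de b1 b2 : 0 <= p <= 1 -> am * p <= al ->
    0 <= a * p + b * al -> b1 ^+ 2 + b2 ^+ 2 <= (a * p + b * al) * (1 - p) ->
    err p (1 - p) al de b1 b2 <= 1 -> box (p, (al, (de, (b1, b2)))).
  move=> /andP[p0 p1] amp abp bb e1.
  have [e11 e12 e13] : [/\ `|al + b1 - z1 * p| <= 1,
      `|de - b1 - z1 * (1 - p)| <= 1 & `|b2 - z2 * p| <= 1].
    move: e1; rewrite /err.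
    have := normr_ge0 (al + b1 - z1 * p).
    have := normr_ge0 (de - b1 - z1 * (1 - p)).
    have := normr_ge0 (b2 - z2 * p); have := normr_ge0 (b2 - z2 * (1 - p)).
    move: `|_| `|_| `|_| `|_| => x1 x2 x3 x4 *; split; lra.
  have q0 : 0 <= 1 - p by rewrite subr_ge0.
  have q1 : 1 - p <= 1 by rewrite gerBl.
  have zp (z : R) : `|z * p| <= `|z|.
    by rewrite normrM (ger0_norm p0) ler_piMr.
  have zq (z : R) : `|z * (1 - p)| <= `|z|.
    by rewrite normrM (ger0_norm q0) ler_piMr.
  have hal : `|al| <= 1 + `|b1| + `|z1|.
    have -> : al = (al + b1 - z1 * p) - b1 + z1 * p by ring.
    apply: le_trans (ler_normD _ _) _; rewrite lerD//.
    by apply: le_trans (ler_normB _ _) _; rewrite lerD2r.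
  have hde : `|de| <= 1 + `|b1| + `|z1|.
    have -> : de = (de - b1 - z1 * (1 - p)) + b1 + z1 * (1 - p) by ring.
    apply: le_trans (ler_normD _ _) _; rewrite lerD//.
    by apply: le_trans (ler_normD _ _) _; rewrite lerD2r.
  have hb2 : `|b2| <= 1 + `|z2|.
    have -> : b2 = (b2 - z2 * p) + z2 * p by ring.
    by apply: le_trans (ler_normD _ _) _; rewrite lerD.
  have hb1 : `|b1| <= P + b + 1.
    have hP : `|b1| ^+ 2 <= P + b * `|b1|.
      rewrite real_normK ?num_real//; apply: le_trans (_ : a * p + b * al <= _).
        apply: le_trans (_ : (a * p + b * al) * (1 - p) <= _); last first.
          by rewrite ler_piMr.
        by apply: le_trans bb; rewrite lerDl sqr_ge0.
      apply: le_trans (_ : `|a| + b * (1 + `|b1| + `|z1|) <= _).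
        rewrite lerD//; first by apply: le_trans (ler_norm _) (zp _).
        by rewrite ler_wpM2l//; apply: le_trans (ler_norm _) hal.
      by rewrite /P; lra.
    by move: hP P0 b0; apply: quad_bound; exact: normr_ge0.
  have hC (x : R) : `|x| <= C -> `[- C, C]%classic x.
    by rewrite /= in_itv /= ler_norml.
  split => /=; first by rewrite in_itv /= p0.
  by do !split; apply: hC; rewrite /C; move: hal hde hb2 hb1 z10 z20 b0 P0;
    move: (P) `|al| `|de| `|b1| `|b2| `|z1| `|z2| => *; lra.
(* Admissible points have zero penalty, so [F] equals [err] there. Those with residual above 1 may
   leave the box, which is why the minimum with 1 is taken. *)
have unit p al de b1 b2 :
    [/\ 0 <= p, 0 <= 1 - p, am * p <= al, de <= dp * (1 - p)
      & (db -> dm * (1 - p) <= de)] ->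
    0 <= a * p + b * al -> b1 ^+ 2 + b2 ^+ 2 <= (a * p + b * al) * (1 - p) ->
    Num.min (F t0) 1 <= err p (1 - p) al de b1 b2.
  move=> [p0 q0 amp dpq dmq] abp bb; rewrite ge_min.
  have [e1|/ltW ->] := leP (err p (1 - p) al de b1 b2) 1; last by rewrite orbT.
  have p01 : 0 <= p <= 1 by rewrite p0; lra.
  have := tmin _ (mem_set (bounded _ _ _ _ _ p01 amp abp bb e1)).
  suff -> : F (p, (al, (de, (b1, b2)))) = err p (1 - p) al de b1 b2 by move->.
  rewrite /F /= /pen; apply/eqP; rewrite -subr_eq0 addrAC subrr add0r.
  have -> : (if db then ppen (dm * (1 - p) - de) else 0) = 0.
    by case: (db) dmq => // dmq; rewrite ppen_le0// subr_le0 dmq.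
  by rewrite !ppen_le0 ?addr0 ?subr_le0 ?oppr_le0.
exists (Num.min (F t0) 1); first by rewrite lt_min F0 ltr01.
move=> p q al de b1 b2 [p0 q0 amp dpq dmq] abp bb.
have [N0|Nn] := eqVneq (p + q) 0; first by rewrite N0 mulr0 !addr_ge0.
have N0 : 0 < p + q by rewrite lt_def Nn addr_ge0.
set N := p + q in N0 *.
have qN : 1 - p / N = q / N by rewrite /N; field; rewrite gt_eqF.
have Ni : 0 < N^-1 by rewrite invr_gt0.
have divN (x y : R) : x <= y -> x / N <= y / N by rewrite ler_pM2r.
have db' : db -> dm * (q / N) <= de / N by move=> /dmq; rewrite mulrA ler_pM2r.
have := unit (p / N) (al / N) (de / N) (b1 / N) (b2 / N); rewrite qN.
have -> : err (p / N) (q / N) (al / N) (de / N) (b1 / N) (b2 / N) =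
    err p q al de b1 b2 / N.
  have nE x : `|x / N| = `|x| / N by rewrite normrM (gtr0_norm Ni).
  have e1 : al / N + b1 / N - z1 * (p / N) = (al + b1 - z1 * p) / N by ring.
  have e2 : de / N - b1 / N - z1 * (q / N) = (de - b1 - z1 * q) / N by ring.
  have e3 x : b2 / N - z2 * (x / N) = (b2 - z2 * x) / N by ring.
  by rewrite /err e1 e2 !e3 !nE -!mulrDl.
move=> U; rewrite -ler_pdivlMr//; apply: U.
- split => //; rewrite ?divr_ge0 ?mulrA ?divN//; exact: ltW.
- by rewrite !mulrA -mulrDl divr_ge0// ltW.
- have -> : (b1 / N) ^+ 2 + (b2 / N) ^+ 2 = (b1 ^+ 2 + b2 ^+ 2) * N^-1 ^+ 2 by ring.
  have -> : (a * (p / N) + b * (al / N)) * (q / N) =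
    ((a * p + b * al) * q) * N^-1 ^+ 2 by ring.
  by rewrite ler_wpM2r// sqr_ge0.
Qed.
End Gap.
End Enclosure.

(** * Closed ranges *)

Section ClosedRange.
Context (R : realType) (E : lmodType R[i]).
Context (h : E -> E -> R[i]) (hh : herm_on setT h).
Let Q x : R := complex.Re (h x x).
Hypothesis Q_ge0 : forall x, 0 <= Q x.
Hypothesis Q_eq0 : forall x, Q x <= 0 -> x = 0.
Hypothesis hcompl : qform_complete setT h.

(** The Riesz representative on [V] of [h^~ e] is the orthogonal projection of [e], and the
    difference is orthogonal to [V]. *)
Lemma orthogonal_trivial_full (V : set E) : lin_subspace V -> qform_complete V h ->
  (forall e, (forall x, V x -> h x e = 0) -> e = 0) -> forall e, V e.
Proof.
move=> sV cV oV e; have [_ hl hC] := hh.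
have hV : herm_on V h.
  split=> [|z Vz c x y Vx Vy|x y _ _]; first exact: sV.
    exact: hl.
  exact: hC.
have [v Vv hv] : exists2 v, V v & forall x, V x -> h x e = h x v.
  apply: (riesz hV _ cV (l := h^~ e) (C := Q e)) => [x _|||x _].
  - exact: Q_ge0.
  - exact: Q_ge0.
  - by move=> c x y Vx Vy; exact: hl.
  - by rewrite mulrC; exact: (herm_CS hh (fun x _ => Q_ge0 x) I I).
suff -> : e = v by [].
apply/eqP; rewrite -subr_eq0; apply/eqP; apply: oV => x Vx.
have -> : e - v = (-1) *: v + e by rewrite scaleN1r addrC.
rewrite (herm_linDr hh)// hv// rmorphN1 mulN1r addNr //.
Qed.

Lemma quad0 : Q 0 = 0.
Proof.
have [_ hl _] := hh; have := hl 0 I (-1) 0 0 I I.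
by rewrite /Q scaler0 add0r mulN1r addNr => ->.
Qed.

Lemma quadZ c x : Q (c *: x) = nsqc c * Q x.
Proof.
have [_ hl hC] := hh.
have h0 : h x 0 = 0.
  rewrite (hC 0)//; have := hl x I (-1) 0 0 I I.
  by rewrite scaler0 add0r mulN1r addNr => ->; rewrite rmorph0.
rewrite -[c *: x]addr0 /Q (herm_quadD hh)// h0 mulr0 -/(Q _) -/(Q _) quad0.
by rewrite reimE; ring.
Qed.

Lemma quad_triangle x y z : Q (x - z) <= 2 * (Q (x - y) + Q (y - z)).
Proof.
have := Q_ge0 ((x - y) - (y - z)).
have -> : x - z = 1 *: (x - y) + (y - z) by rewrite scale1r addrA subrK.
have -> : x - y - (y - z) = (-1) *: (y - z) + (x - y) by rewrite scaleN1r addrC.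
rewrite /Q !(herm_quadD hh)// -/(Q _) /nsqc !reimE.
have [_ _ hC] := hh; rewrite (hC (x - y) (y - z))// reimE.
rewrite -!/(Q _) /=.
move: (Q _) (Q _) (complex.Re _) => *; lra.
Qed.

Variables (T : set (E * E)) (z : R[i]) (C : R).
Hypothesis sT : lin_subspace T.
Hypothesis T_closed : forall x y, (forall e : R, 0 < e -> exists x' y',
  [/\ T (x', y'), Q (x - x') < e & Q (y - y') < e]) -> T (x, y).
Hypothesis T_below : forall x y, T (x, y + z *: x) -> Q x <= C * Q y.
Hypothesis T_orth :
  forall e, (forall x y, T (x, y + z *: x) -> h y e = 0) -> e = 0.

Lemma graphB x y x' y' : T (x, y + z *: x) -> T (x', y' + z *: x') ->
  T (x - x', (y - y') + z *: (x - x')).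
Proof.
move=> Tx Tx'; have := lin_subspaceB sT Tx Tx'.
by congr (T (_, _)) => /=; rewrite scalerBr opprD addrACA.
Qed.

Lemma resolvent_inj y x x' :
  T (x, y + z *: x) -> T (x', y + z *: x') -> x = x'.
Proof.
move=> Tx Tx'; have := T_below (graphB Tx Tx').
by rewrite subrr quad0 mulr0 => /Q_eq0/eqP; rewrite subr_eq0 => /eqP.
Qed.

(** [T_below] turns a Cauchy sequence of images into a Cauchy sequence of preimages, and [T_closed]
    identifies the limit; so the range is complete, and [T_orth] leaves no room for a complement. *)
Lemma closed_range y : exists x, T (x, y + z *: x).
Proof.
pose W : set E := [set y | exists x, T (x, y + z *: x)].
suff : W y by [].
have sW : lin_subspace W.
  split; first by exists 0; rewrite scaler0 addr0; exact: sT.1.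
  move=> c y1 y2 [x1 T1] [x2 T2]; exists (c *: x1 + x2).
  have := sT.2 c _ _ T1 T2; congr (T (_, _)) => /=.
  by rewrite !scalerDr addrACA; congr (_ + (_ + _)); rewrite !scalerA mulrC.
apply: orthogonal_trivial_full => // [u Wu cu|e he]; last first.
  by apply: T_orth => x w Txw; apply: he; exists x.
have /choice[v hv] := Wu.
have C1 : 0 < `|C| + 1 by rewrite ltr_pwDr.
have Qv n m : Q (v n - v m) <= (`|C| + 1) * Q (u n - u m).
  apply: le_trans (T_below (graphB (hv n) (hv m))) _.
  by rewrite ler_wpM2r//; have := ler_norm C; lra.
have [//|x _ hx] := hcompl (u := v) (fun=> I).
  move=> e e0; have [N hN] := cu _ (divr_gt0 e0 C1).
  exists N => n m Nn Nm; apply: le_lt_trans (Qv n m) _.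
  by rewrite mulrC -ltr_pdivlMr//; exact: hN.
have [//|w _ hw] := hcompl (u := u) (fun=> I).
exists w => //; exists x; apply: T_closed => e e0.
have QC x1 x2 : Q (x1 - x2) = Q (x2 - x1).
  by rewrite -(opprB x2 x1) -(scaleN1r (x2 - x1)) quadZ /nsqc !reimE; ring.
(* Error budget: [z *: (x - v N)] and [w - u N] may each contribute [e / 4] before the factor 2 of
   [quad_triangle]. *)
pose K := 4 * (nsqc z + 1).
have K0 : 0 < K by rewrite mulr_gt0// ltr_pwDr// nsqc_ge0.
have [N1 h1] := hx _ e0; have [N2 h2] := hw _ (divr_gt0 e0 (ltr0n _ 4)).
have [N3 h3] := hx _ (divr_gt0 e0 K0).
pose N := maxn N1 (maxn N2 N3).
exists (v N), (u N + z *: v N); split; first exact: hv.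
  by rewrite QC; apply: h1; rewrite leq_maxl.
apply: le_lt_trans (quad_triangle _ (u N + z *: x) _) _.
have -> : w + z *: x - (u N + z *: x) = w - u N by rewrite opprD addrACA subrr addr0.
have -> : u N + z *: x - (u N + z *: v N) = z *: (x - v N).
  by rewrite opprD addrACA subrr add0r scalerBr.
rewrite quadZ QC (QC x).
have := h2 N; have := h3 N; rewrite !leq_max !leqnn !orbT => /(_ isT) + /(_ isT).
rewrite -!/(Q _) ltr_pdivlMr// /K.
have := nsqc_ge0 z; have := Q_ge0 (v N - x).
move: (Q _) (Q _) (nsqc z) => X Y t X0 t0 hX hY.
by lra.
Qed.

End ClosedRange.

(** * Self-adjoint operators *)

Section HilbertForm.
Context (R : realType) (H : hilbertType R).

Lemma inner_herm : herm_on setT (@inner R H).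
Proof.
split=> // [z _ c x y _ _|x y _ _]; last exact: innerC.
by rewrite innerDl innerZl.
Qed.

Lemma inner_complete : qform_complete setT (@inner R H).
Proof.
move=> u _ /hilbert_complete[x /cvg_nsq ux]; exists x => //; exact: ux.
Qed.

Lemma inner_CS (x y : H) : nsqc (inner x y) <= nsq x * nsq y.
Proof. exact: (herm_CS inner_herm (fun x _ => nsq_ge0 x) I I). Qed.

Lemma nsqZ c (x : H) : nsq (c *: x) = nsqc c * nsq x.
Proof. exact: (quadZ inner_herm). Qed.

Lemma nsq0 : nsq (0 : H) = 0.
Proof. exact: (quad0 inner_herm). Qed.

Lemma nsqN (x : H) : nsq (- x) = nsq x.
Proof. by rewrite /nsq innerNl innerNr opprK. Qed.

Lemma nsqBC (x y : H) : nsq (x - y) = nsq (y - x).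
Proof. by rewrite -opprB nsqN. Qed.

Lemma nsqc_small (z : R[i]) (C : R) : 0 <= C ->
  (forall e, 0 < e -> nsqc z <= C * e) -> z = 0.
Proof.
move=> C0 h; apply: nsqc_eq0; rewrite leNgt; apply/negP => z0.
have C1 : 0 < C + 1 by rewrite ltr_pwDr.
have := h _ (divr_gt0 z0 C1); rewrite mulrA ler_pdivlMr// mulrDr mulr1 mulrC.
by rewrite leNgt ltrDl z0.
Qed.

Lemma norm_le_nsq (x y : H) (C : R) : 0 <= C -> nsq x <= C * nsq y ->
  `|x| <= (Num.sqrt C)%:C * `|y|.
Proof.
move=> C0 h; rewrite !norm_nsq -rmorphM lecR /= -sqrtrM//.
exact: ler_wsqrtr.
Qed.

Lemma nsq_le_norm (x y : H) (C : R) : `|x| <= C%:C * `|y| ->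
  nsq x <= C ^+ 2 * nsq y.
Proof.
rewrite !norm_nsq -rmorphM lecR /= => h.
rewrite -(sqr_sqrtr (nsq_ge0 x)) -(sqr_sqrtr (nsq_ge0 y)) -exprMn.
by rewrite ler_pXn2r ?nnegrE ?sqrtr_ge0// (le_trans _ h)// sqrtr_ge0.
Qed.

Lemma Re_inner_le (x y : H) (K : R) : 0 <= K -> nsq x <= K ^+ 2 * nsq y ->
  complex.Re (inner x y) <= K * nsq y.
Proof.
move=> K0 h; have := inner_CS x y; rewrite /nsqc.
have := sqr_ge0 (complex.Im (inner x y)).
have := nsq_ge0 y; move: (complex.Re _) (complex.Im _) => r s y0 s0 le.
rewrite leNgt; apply/negP => lt.
have Ky : 0 <= K * nsq y by exact: mulr_ge0.
have : nsq x * nsq y <= K ^+ 2 * nsq y * nsq y by rewrite ler_wpM2r.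
have : (K * nsq y) ^+ 2 < r ^+ 2 by rewrite ltr_pXn2r ?nnegrE// (le_trans Ky)// ltW.
by lra.
Qed.

End HilbertForm.

Section SelfAdjoint.
Context (R : realType) (H : hilbertType R).
Implicit Types T : set (H * H).

Definition apply_op T x : H := xget 0 [set y | T (x, y)].

Lemma submod_lin_subspace (E : lmodType R[i]) (V : set E) :
  submod_closed [in V] -> lin_subspace V.
Proof.
move=> [V0 l]; split; first exact: set_mem V0.
by move=> c x y /mem_set Vx /mem_set Vy; exact: set_mem (l c x y Vx Vy).
Qed.

Lemma lin_subspace_dom (K : hilbertType R) (T : set (H * K)) :
  lin_subspace T -> lin_subspace (dom T).
Proof.
move=> [T0 l]; split; first by exists 0.
move=> c x y [x' Tx] [y' Ty]; exists (c *: x' + y').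
exact: (l c (x, x') (y, y')).
Qed.

Lemma resolvent_setI T (z : R[i]) (C : R) : lin_subspace T ->
  (forall x y, T (x, y + z *: x) -> nsq x <= C * nsq y) ->
  (forall y, exists x, T (x, y + z *: x)) -> resolvent_set T z.
Proof.
move=> sT TC surj; split=> [y|].
  have [x Tx] := surj y; exists x; split=> // x' Tx'.
  by apply: (resolvent_inj (inner_herm _) (@nsq_eq0 _ _) sT TC) Tx Tx'.
exists (Num.sqrt `|C|) => x y Txy; apply: norm_le_nsq => //.
apply: le_trans (TC _ _ Txy) _; rewrite ler_wpM2r ?nsq_ge0//.
exact: ler_norm.
Qed.

Section Facts.
Variable T : set (H * H).
Hypothesis sT : selfadjoint T.

Lemma sa_subspace : lin_subspace T.
Proof. by have [[/submod_lin_subspace]] := sT. Qed.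

Lemma apply_opP x : dom T x -> T (x, apply_op T x).
Proof. by move=> h; have := @xgetPex _ (0 : H) [set y | T (x, y)] h. Qed.

Lemma apply_opE x y : T (x, y) -> apply_op T x = y.
Proof.
move=> Txy; have [[_ f] _ _] := sT.
by apply: (f x) => //; apply: apply_opP; exists y.
Qed.

Lemma sa_sym x x' y y' : T (x, x') -> T (y, y') -> inner x' y = inner x y'.
Proof.
by have [_ _ aT] := sT; move=> Tx; rewrite -{1}aT; apply.
Qed.

Lemma sa_max y y' :
  (forall x x', T (x, x') -> inner x' y = inner x y') -> T (y, y').
Proof. by move=> h; have [_ _ <-] := sT. Qed.

(** Membership in an adjoint is a family of identities between inner products, each of which passes
    to limits. *)
Lemma sa_closed x y : (forall e : R, 0 < e -> exists x' y',
  [/\ T (x', y'), nsq (x - x') < e & nsq (y - y') < e]) -> T (x, y).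
Proof.
move=> h; apply: sa_max => u u' Tu; apply/eqP; rewrite -subr_eq0; apply/eqP.
apply: (@nsqc_small _ _ (2 * (nsq u' + nsq u))).
  by rewrite mulr_ge0// addr_ge0 ?nsq_ge0.
move=> e e0; have [x' [y' [Txy hx hy]]] := h e e0.
have -> : inner u' x - inner u y = inner u' (x - x') + - inner u (y - y').
  by rewrite !innerBr (sa_sym Tu Txy); ring.
apply: le_trans (nsqcD_le _ _) _; rewrite -mulrA ler_pM2l// mulrDl.
have -> : nsqc (- inner u (y - y')) = nsqc (inner u (y - y')).
  by rewrite /nsqc !reimE !sqrrN.
by apply: lerD; apply: le_trans (inner_CS _ _) _;
  rewrite ler_wpM2l ?nsq_ge0 ?ltW.
Qed.

Lemma sa_form_herm (t : R) :
  herm_on (dom T) (fun x y => inner (apply_op T x) y - t%:C * inner x y).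
Proof.
have [T0 l] := sa_subspace.
split; first exact: (lin_subspace_dom sa_subspace).
  move=> z Tz c x y Tx Ty.
  have -> : apply_op T (c *: x + y) = c *: apply_op T x + apply_op T y.
    by apply: apply_opE; exact: (l c (x, _) (y, _) (apply_opP Tx) (apply_opP Ty)).
  by rewrite !innerDl !innerZl; ring.
move=> x y Tx Ty; rewrite (sa_sym (apply_opP Ty) (apply_opP Tx)).
rewrite (innerC (apply_op T x)) (innerC x).
by apply: complex_ext; rewrite !reimE; ring.
Qed.

Lemma sa_below (t c : R) x y : 0 < c ->
  (forall x x', T (x, x') -> (t + c) * nsq x <= complex.Re (inner x' x)) ->
  T (x, y + t%:C *: x) -> nsq x <= c ^- 2 * nsq y.
Proof.
move=> c0 h Txy; rewrite mulrC ler_pdivlMr ?exprn_gt0//; move: Txy => /h.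
rewrite innerDl innerZl inner_nsq !reimE => le.
have {le} le : c * nsq x <= complex.Re (inner y x) by lra.
have := inner_CS y x; rewrite /nsqc.
have := sqr_ge0 (complex.Im (inner y x)); have := nsq_ge0 x.
move: (complex.Re _) (complex.Im _) le => r s le x0 s0 le2.
have [x00|] := eqVneq (nsq x) 0; first by rewrite x00 mul0r nsq_ge0.
move=> xn; have {xn}x0 : 0 < nsq x by rewrite lt_def xn.
rewrite -(ler_pM2r x0); apply: le_trans (_ : (c * nsq x) ^+ 2 <= _).
  by rewrite le_eqVlt; apply/orP; left; apply/eqP; ring.
apply: le_trans (_ : r ^+ 2 <= _); last by lra.
have cx : 0 <= c * nsq x by rewrite mulr_ge0 ?ltW.
by rewrite ler_pXn2r ?nnegrE// (le_trans cx le).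
Qed.

(** As [t] is real, a vector orthogonal to the range of [T - t] lies in the domain of the adjoint,
    hence of [T], and is an eigenvector for [t] or zero; the lower bound [t + c] leaves only
    zero. *)
Lemma sa_surj (t c : R) : 0 < c ->
  (forall x x', T (x, x') -> (t + c) * nsq x <= complex.Re (inner x' x)) ->
  forall y, exists x, T (x, y + t%:C *: x).
Proof.
move=> c0 h.
apply: (closed_range (inner_herm H) (@nsq_ge0 _ _)
  (@inner_complete _ _) sa_subspace sa_closed (C := c ^- 2)).
  by move=> x y; exact: sa_below.
move=> e he; apply: nsq_eq0.
have Te : T (e, 0 + t%:C *: e).
  apply: sa_max => x x' Txx'; have := he x (x' - t%:C *: x).
  rewrite subrK => /(_ Txx'); rewrite innerBl innerZl add0r innerZr => /eqP.
  by rewrite subr_eq0 => /eqP ->; congr (_ * _); apply: complex_ext; rewrite !reimE ?oppr0.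
by have := sa_below c0 h Te; rewrite nsq0 mulr0.
Qed.

Lemma set_min_eq (E : set R) m : E m -> lbound E m -> set_min E = m.
Proof.
move=> Em lm; have [] := @getPex _ [set m | E m /\ lbound E m].
  by exists m.
by rewrite -/(set_min E) => h1 h2; apply/eqP; rewrite eq_le h2// lm.
Qed.

(* At the infimum [m] of the numerical range a bounded inverse of [T - m] would
   be a nonnegative operator, and Cauchy-Schwarz for the form of [T - m] at [x]
   and [(T - m)^-1 x] would improve the lower bound [m]. *)
Lemma sa_spectrum_min : (exists x : H, x != 0) -> form_bounded_below T ->
  real_spectrum T (set_min (real_spectrum T)) /\
  lbound (real_spectrum T) (set_min (real_spectrum T)) /\
  forall x x', T (x, x') ->
    set_min (real_spectrum T) * nsq x <= complex.Re (inner x' x).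
Proof.
move=> [x0 x0n] [m1 hm1].
pose E : set R := [set t | forall x x', T (x, x') -> t * nsq x <= complex.Re (inner x' x)].
have Em1 : E m1.
  by move=> x x' /hm1; rewrite norm2_nsq -rmorphM lecE /= => /andP[].
have x0p : 0 < nsq x0.
  rewrite lt_def nsq_ge0 andbT; apply: contra x0n => /eqP h.
  by apply/eqP/nsq_eq0; rewrite h.
have [_ dT _] := sT.
(* Approximating [x0] strictly within its own length yields a nonzero vector of the domain; its
   Rayleigh quotient bounds [E] from above. *)
have [y [y' Ty] xy] := dense_nsq dT x0 x0p.
have yp : 0 < nsq y.
  rewrite lt_def nsq_ge0 andbT; apply/eqP => h.
  have y0 : y = 0 by apply: nsq_eq0; rewrite h.
  by move: xy; rewrite y0 subr0 ltxx.
have E_sup : has_sup E.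
  split; first by exists m1.
  exists (complex.Re (inner y' y) / nsq y) => t Et.
  by rewrite ler_pdivlMr//; exact: Et.
set m := sup E.
have Em : E m.
  move=> x x' Tx; rewrite leNgt; apply/negP => lt.
  have [x00|xn] := eqVneq (nsq x) 0.
    by have := Em1 _ _ Tx; move: lt; rewrite x00 !mulr0 => /lt_le_trans h /h; rewrite ltxx.
  have xp : 0 < nsq x by rewrite lt_def xn nsq_ge0.
  have e0 : 0 < m - complex.Re (inner x' x) / nsq x by rewrite subr_gt0 ltr_pdivrMr.
  have [t Et] := sup_adherent e0 E_sup.
  rewrite -/m opprB addrC subrK ltr_pdivrMr// => lt2.
  by have := lt_le_trans lt2 (Et _ _ Tx); rewrite ltxx.
have lb : lbound (real_spectrum T) m.
  move=> t; rewrite leNgt; apply: contra_notN => tm.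
  have c0 : 0 < m - t by rewrite subr_gt0.
  have h x x' : T (x, x') -> (t + (m - t)) * nsq x <= complex.Re (inner x' x).
    by rewrite addrC subrK; exact: Em.
  apply: (resolvent_setI (C := (m - t) ^- 2)) => [|u v|].
  - exact: sa_subspace.
  - exact: sa_below c0 h.
  - exact: sa_surj c0 h.
suff sm : real_spectrum T m by rewrite (set_min_eq sm lb).
move=> [surj [C hC]].
pose K := `|C| + 1; have K0 : 0 < K by rewrite ltr_pwDr.
have h_herm := sa_form_herm m.
have h_ge0 x : dom T x ->
    0 <= complex.Re (inner (apply_op T x) x - m%:C * inner x x).
  by move=> Tx; rewrite !reimE mul0r subr0 subr_ge0; apply: Em; exact: apply_opP.
have : E (m + K^-1).
  move=> x x' Tx; have [w [Tw _]] := surj x.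
  have dx : dom T x by exists x'.
  have dw : dom T w by exists (x + m%:C *: w).
  (* Since [(T - m) w = x], this reads [|x|^4 <= Re <w, x> * <(T - m) x, x>], and
     [Re <w, x> <= K |x|^2]. *)
  have := herm_CS h_herm h_ge0 dw dx.
  rewrite (apply_opE Tw) (apply_opE Tx) !innerDl !innerZl !addrK.
  rewrite inner_nsq {1}/nsqc !reimE expr0n addr0 mul0r subr0.
  have /(Re_inner_le _) : nsq w <= K ^+ 2 * nsq x.
    apply: le_trans (nsq_le_norm (hC _ _ Tw)) _.
    rewrite ler_wpM2r ?nsq_ge0// -(real_normK (num_real C)).
    by rewrite ler_pXn2r ?nnegrE// ?addr_ge0// lerDl.
  move=> /(_ (ltW K0)); rewrite innerC reimE.
  have := Em _ _ Tx; rewrite -subr_ge0.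
  set r := complex.Re (inner x w); set a := _ - _ => a0 h1 h2.
  suff h3 : nsq x <= K * a.
    by rewrite mulrDl -lerBrDl [K^-1 * _]mulrC ler_pdivrMr// mulrC.
  have [x00|xn] := eqVneq (nsq x) 0; first by rewrite x00 mulr_ge0// ltW.
  have xp : 0 < nsq x by rewrite lt_def xn nsq_ge0.
  rewrite -(ler_pM2l xp) -expr2; apply: le_trans h2 _.
  by rewrite mulrA (mulrC _ K) ler_wpM2r.
move/(sup_upper_bound E_sup); rewrite -/m gerDl leNgt invr_gt0 K0 //.
Qed.

End Facts.
End SelfAdjoint.

Section RealNumericalRange.
Context (R : realType).

Lemma sa_Im0 (H : hilbertType R) (T : set (H * H)) x x' :
  selfadjoint T -> T (x, x') -> complex.Im (inner x' x) = 0.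
Proof.
move=> sT Tx; have := sa_sym sT Tx Tx; rewrite [in X in _ = X -> _]innerC.
by move/(congr1 (@complex.Im R)); rewrite ImJ; lra.
Qed.

End RealNumericalRange.

(** * From the bottom to the top of the spectrum *)

Section Negation.
Context (R : realType) (H : hilbertType R).
Implicit Types T : set (H * H).

Definition neg_op T : set (H * H) := [set p | T (p.1, - p.2)].

Lemma neg_selfadjoint T : selfadjoint T -> selfadjoint (neg_op T).
Proof.
move=> sT; have [T0 Tl] := sa_subspace sT; have [[_ Tf] dT _] := sT.
split.
- split.
    split; first by apply: mem_set; rewrite /neg_op /= oppr0.
    move=> c [x x'] [y y'] /set_mem Tx /set_mem Ty; apply: mem_set.
    have := Tl c _ _ Tx Ty; congr (T (_, _)) => /=.
    by rewrite opprD scalerN.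
  by move=> x y z /= Ty Tz; apply: oppr_inj; exact: Tf Ty Tz.
- move=> U U0 /(dT U U0)[x [Ux [x' Tx]]].
  by exists x; split=> //; exists (- x'); rewrite /neg_op /= opprK.
- apply/seteqP; split=> -[y y'] /= h.
    apply: (sa_max sT) => x x' Tx; rewrite innerNr.
    have := h x (- x'); rewrite /neg_op /= opprK innerNl => /(_ Tx) <-.
    by rewrite opprK.
  move=> x x' Tx; have := sa_sym sT Tx h.
  by rewrite innerNl innerNr => /oppr_inj.
Qed.

Lemma neg_resolvent T z : resolvent_set T z -> resolvent_set (neg_op T) (- z).
Proof.
move=> [ex [C hC]].
have e y x : - (y + - z *: x) = - y + z *: x by rewrite scaleNr opprB addrC.
split=> [y|].
  have [x [Tx ux]] := ex (- y); exists x; split; rewrite /neg_op /= ?e//.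
  by move=> x'; rewrite e; exact: ux.
by exists C => x y; rewrite /neg_op /= e => /hC; rewrite normrN.
Qed.

Lemma neg_opK T : neg_op (neg_op T) = T.
Proof. by apply/seteqP; split=> -[x y]; rewrite /neg_op /= opprK. Qed.

Lemma neg_spectrum T t : real_spectrum (neg_op T) t <-> real_spectrum T (- t).
Proof.
rewrite /real_spectrum /spectrum /= rmorphN; split; apply: contra_not.
  by move/neg_resolvent; rewrite opprK.
by move/neg_resolvent; rewrite neg_opK.
Qed.

Lemma set_max_eq (E : set R) m : E m -> ubound E m -> set_max E = m.
Proof.
move=> Em lm; have [] := @getPex _ [set m | E m /\ ubound E m].
  by exists m.
by rewrite -/(set_max E) => h1 h2; apply/eqP; rewrite eq_le h2// lm.
Qed.

Lemma sa_spectrum_max T : selfadjoint T -> (exists x : H, x != 0) ->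
  form_bounded_above T -> forall x x', T (x, x') ->
    complex.Re (inner x' x) <= set_max (real_spectrum T) * nsq x.
Proof.
move=> sT x0 [k hk].
have nT : form_bounded_below (neg_op T).
  exists (- k) => x y /hk; rewrite innerNl norm2_nsq -!rmorphM /= mulNr rmorphN /=.
  by rewrite lerNl.
have [mE [mlb mle]] := sa_spectrum_min (neg_selfadjoint sT) x0 nT.
have -> : set_max (real_spectrum T) = - set_min (real_spectrum (neg_op T)).
  apply: set_max_eq; first exact/neg_spectrum.
  move=> t Tt; rewrite lerNr; apply: mlb; apply/neg_spectrum.
  by rewrite opprK.
move=> x x' Tx; have := mle x (- x'); rewrite /neg_op /= opprK => /(_ Tx).
by rewrite innerNl reimE mulNr lerNr.
Qed.

End Negation.

(** * The form of a semibounded self-adjoint operator *)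

Section AssociatedForm.
Context (R : realType) (H : hilbertType R) (A : set (H * H)) (fa : qform H).
Hypothesis sA : selfadjoint A.
Hypothesis hfa : associated_form A fa.

Lemma assoc_herm : herm_on (fdom fa) (fval fa).
Proof.
have [[/submod_lin_subspace sV fl fC] _ _ _ _] := hfa.
by split=> // z Vz c x y Vx Vy; exact: fl.
Qed.

Lemma assoc_val x x' y : A (x, x') -> fdom fa y -> fval fa x y = inner x' y.
Proof. by move=> Ax Vy; have [_ _ _ _ /(_ _ _ Ax)[_ ->]] := hfa. Qed.

Lemma assoc_dom x x' : A (x, x') -> fdom fa x.
Proof. by move=> Ax; have [_ _ _ _ /(_ _ _ Ax)[]] := hfa. Qed.

(** Taking [y] in [S] with [|w - y|^2 < |w|^2 / 4], the error uses up half of [|w|^4] and the rest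
    is at most [8 M |w|^2]. The constant 16 is crude but harmless, also for [M = 0]. *)
Lemma dense_norm (S : set H) (w : H) (M : R) : dense S -> 0 <= M ->
  (forall y, S y -> nsqc (inner w y) <= M * nsq y) -> nsq w <= 16 * M.
Proof.
move=> dS M0 h; have [w0|] := leP (nsq w) 0.
  by apply: le_trans w0 _; rewrite mulr_ge0.
move=> w0; have [y Sy wy] := dense_nsq dS w (divr_gt0 w0 (ltr0n _ 4)).
have h1 := h _ Sy; have h2 := inner_CS w (w - y).
have h3 : nsq w ^+ 2 <= 2 * (nsqc (inner w y) + nsqc (inner w (w - y))).
  have -> : nsq w ^+ 2 = nsqc (inner w y + inner w (w - y)).
    by rewrite -innerDr addrC subrK inner_nsq /nsqc !reimE; ring.
  exact: nsqcD_le.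
have h4 : nsq y <= 2 * (nsq (y - w) + nsq w).
  by rewrite -{1}(subrK w y); exact: nsqD_le.
rewrite nsqBC in h4.
move: (nsq w) (nsq y) (nsq (w - y)) (nsqc _) (nsqc _) w0 wy h1 h2 h3 h4.
move=> n ny e c1 c2 n0 en h1 h2 h3 h4.
have h5 : n * e <= n * (n / 4) by rewrite ler_pM2l// ltW.
have h6 : M * ny <= M * (4 * n) by rewrite ler_wpM2l//; lra.
rewrite -(ler_pM2l n0); lra.
Qed.

(** Cauchy-Schwarz for the form of [A - m], whose values lie between 0 and [|k - m| |x|^2], bounds
    [<(A - m) x, y>] for [y] in the dense domain; by [dense_norm] the operator is bounded. A closed,
    densely defined, bounded operator is everywhere defined. *)
Lemma bounded_full (m k : R) :
  (forall x x', A (x, x') -> m * nsq x <= complex.Re (inner x' x) <= k * nsq x) ->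
  forall u, dom A u.
Proof.
move=> mk u; have [_ dA _] := sA.
have hh := sa_form_herm sA m.
have re x x' : A (x, x') ->
    complex.Re (inner (apply_op A x) x - m%:C * inner x x) =
    complex.Re (inner x' x) - m * nsq x.
  by move=> Ax; rewrite (apply_opE sA Ax) !reimE mul0r subr0.
have h0 x : dom A x ->
    0 <= complex.Re (inner (apply_op A x) x - m%:C * inner x x).
  by move=> [x' Ax]; rewrite (re _ _ Ax) subr_ge0; case/andP: (mk _ _ Ax).
pose M : R := 16 * `|k - m| ^+ 2.
have hM x x' : A (x, x') -> nsq (x' - m%:C *: x) <= M * nsq x.
  move=> Ax; rewrite -mulrA; apply: (dense_norm dA).
    by rewrite mulr_ge0 ?nsq_ge0 ?sqr_ge0.
  move=> y [y' Ay].
  have dx : dom A x by exists x'.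
  have dy : dom A y by exists y'.
  have := herm_CS hh h0 dx dy; rewrite (re _ _ Ax) (re _ _ Ay) (apply_opE sA Ax).
  rewrite innerBl innerZl => h; apply: le_trans h _.
  have km v v' : A (v, v') ->
      0 <= complex.Re (inner v' v) - m * nsq v <= `|k - m| * nsq v.
    move=> Av; have /andP[h1 h2] := mk _ _ Av; rewrite subr_ge0 h1 /=.
    apply: le_trans (_ : (k - m) * nsq v <= _); first lra.
    by rewrite ler_wpM2r ?nsq_ge0 ?ler_norm.
  have /andP[h1 h2] := km _ _ Ax; have /andP[h3 h4] := km _ _ Ay.
  apply: le_trans (ler_pM h1 h3 h2 h4) _.
  by rewrite le_eqVlt; apply/orP; left; apply/eqP; ring.
pose K := 2 * (M + m ^+ 2) + 1.
have M0 : 0 <= M by rewrite mulr_ge0 ?sqr_ge0.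
have K0 : 0 < K by rewrite ltr_pwDr// mulr_ge0// addr_ge0 ?sqr_ge0.
have hK x x' : A (x, x') -> nsq x' <= K * nsq x.
  move=> Ax; have := nsqD_le (x' - m%:C *: x) (m%:C *: x); rewrite subrK.
  rewrite [nsq (m%:C *: x)]nsqZ /nsqc !reimE.
  have := hM _ _ Ax; have := nsq_ge0 x; rewrite /K.
  move: (nsq _) (nsq _) (nsq _) (M) => *; lra.
have /choice[v hv] : forall n : nat, exists p, A p /\ nsq (u - p.1) < n.+1%:R^-1.
  move=> n; have n0 : 0 < (n.+1%:R^-1 : R) by rewrite invr_gt0.
  have [x [x' Ax] ux] := dense_nsq dA u n0.
  by exists (x, x').
have lim (e : R) : 0 < e -> exists N : nat, forall n, (N <= n)%N -> nsq (u - (v n).1) < e.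
  by move/invrS_lt=> [N hN]; exists N => n /hN; apply: lt_trans (hv n).2.
have Av n : A ((v n).1, (v n).2) by rewrite -surjective_pairing; exact: (hv n).1.
have [w /cvg_nsq hw] : exists w : H, (fun n => (v n).2) @ \oo --> w.
  apply: hilbert_complete => e e0.
  have [N hN] := lim _ (divr_gt0 e0 (mulr_gt0 (ltr0n _ 4) K0)).
  exists N => n p Nn Np.
  have := hK _ _ (lin_subspaceB (sa_subspace sA) (Av n) (Av p)).
  move/le_lt_trans; apply => /=.
  have -> : (v n).1 - (v p).1 = ((v n).1 - u) + (u - (v p).1) by rewrite addrA subrK.
  rewrite mulrC -ltr_pdivlMr//; apply: le_lt_trans (nsqD_le _ _) _.
  have := hN _ Nn; rewrite nsqBC; have := hN _ Np.
  rewrite !invfM; move: (nsq _) (nsq _) (K^-1) => a1 a2 a3; lra.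
exists w; apply: (sa_closed sA) => e e0.
have [N1 h1] := lim _ e0; have [N2 h2] := hw _ e0.
exists (v (maxn N1 N2)).1, (v (maxn N1 N2)).2; split => //.
  by apply: h1; rewrite leq_maxl.
by rewrite nsqBC; apply: h2; rewrite leq_maxr.
Qed.

Variable m : R.
Hypothesis Am : forall x x', A (x, x') -> m * nsq x <= complex.Re (inner x' x).

(* The definition of an associated form allows it to be bounded from above even
   though the operator is bounded from below. *)
Lemma assoc_semibounded :
  (exists k : R, forall x, fdom fa x -> k * nsq x <= complex.Re (quad fa x)) \/
  forall u, dom A u.
Proof.
have [_ [[k hk]|[k hk]] _ _ _] := hfa; [left|right].
  exists k => x /hk; rewrite norm2_nsq -rmorphM lecE /=.
  by case/andP.
apply: (@bounded_full m k) => x x' Ax; rewrite Am//=.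
have := hk _ (assoc_dom Ax); rewrite norm2_nsq -rmorphM lecE /= => /andP[_].
by rewrite /quad (assoc_val Ax (assoc_dom Ax)).
Qed.

Lemma form_shift_herm (t : R) :
  herm_on (fdom fa) (fun x y => fval fa x y - t%:C * inner x y).
Proof.
have [sV fl fC] := assoc_herm.
split=> // [z Vz c x y Vx Vy|x y Vx Vy].
  by rewrite (fl z)// innerDl innerZl; ring.
rewrite fC// (innerC x); apply: complex_ext; rewrite !reimE; ring.
Qed.

(* If [k < m] bounds the form from below, Cauchy-Schwarz for [fa - k] at [x] and
   [(A - k)^-1 x] improves [k] to [m]. *)
Lemma assoc_lower x : fdom fa x -> m * nsq x <= complex.Re (quad fa x).
Proof.
have [[k hk]|full] := assoc_semibounded => Vu; last first.
  by have [x' Ax] := full x; rewrite /quad (assoc_val Ax Vu); exact: Am.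
have [mk|km] := leP m k.
  by apply: le_trans (hk _ Vu); rewrite ler_wpM2r ?nsq_ge0.
have c0 : 0 < m - k by rewrite subr_gt0.
have Ac y y' : A (y, y') -> (k + (m - k)) * nsq y <= complex.Re (inner y' y).
  by rewrite addrC subrK; exact: Am.
have [w Aw] := sa_surj sA c0 Ac x.
have hh := form_shift_herm k.
have h0 y : fdom fa y -> 0 <= complex.Re (fval fa y y - k%:C * inner y y).
  by move=> Vy; rewrite !reimE mul0r subr0 subr_ge0; exact: hk.
have Vw := assoc_dom Aw.
have := herm_CS hh h0 Vw Vu.
rewrite (assoc_val Aw Vu) (assoc_val Aw Vw) !innerDl !innerZl !addrK.
rewrite inner_nsq {1}/nsqc !reimE expr0n addr0 mul0r subr0.
have := sa_below c0 Ac Aw.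
have -> : (m - k) ^- 2 = (m - k)^-1 ^+ 2 by rewrite exprVn.
have ci : 0 <= (m - k)^-1 by rewrite invr_ge0 ltW.
move/(Re_inner_le ci); rewrite innerC reimE -/(quad fa x) -/(nsq x) => h1 h2.
have [x00|xn] := eqVneq (nsq x) 0.
  by apply: le_trans (hk _ Vu); rewrite x00 !mulr0.
have xp : 0 < nsq x by rewrite lt_def xn nsq_ge0.
have a0 : 0 <= complex.Re (quad fa x) - k * nsq x by rewrite subr_ge0 hk.
have : nsq x ^+ 2 <= (m - k)^-1 * nsq x * (complex.Re (quad fa x) - k * nsq x).
  by apply: le_trans h2 _; rewrite ler_wpM2r.
rewrite mulrAC expr2 ler_pM2r// mulrC ler_pdivlMr//; lra.
Qed.

(* A weak solution [u], which is a priori only in [H], has finite energy: by the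
   Riesz representation in the form space, the equation has a solution [u'] in
   [fdom fa], and [u - u'] is orthogonal to the range of [A - t]. *)
Lemma assoc_weak (g : H -> R[i]) (a b : R) (z : R[i]) (u : H) :
  linear_on (fdom fa) g -> 0 <= b ->
  (forall x, fdom fa x ->
     nsqc (g x) <= a * nsq x + b * complex.Re (quad fa x)) ->
  (forall x x', A (x, x') -> inner x' u - z * inner x u = g x) ->
  fdom fa u /\ forall x, fdom fa x -> fval fa x u - z * inner x u = g x.
Proof.
move=> gl b0 gb weak.
have [[k hk]|full] := assoc_semibounded; last first.
  have [u' Au] := full u; split; first exact: assoc_dom Au.
  move=> x _; have [x' Ax] := full x.
  by rewrite (assoc_val Ax (assoc_dom Au)); exact: weak.
(* With this shift [h] dominates [nsq], so [h]-Cauchy sequences converge in [H]. *)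
pose t := m - 1.
pose h x y := fval fa x y - t%:C * inner x y.
have hh : herm_on (fdom fa) h := form_shift_herm t.
have Qge x : fdom fa x -> nsq x <= complex.Re (h x x).
  move=> Vx; have := assoc_lower Vx; rewrite /h /t /quad !reimE -/(nsq x); lra.
have Q0 x : fdom fa x -> 0 <= complex.Re (h x x).
  by move=> Vx; apply: le_trans (nsq_ge0 x) (Qge _ Vx).
have QE x : complex.Re (quad fa x) = complex.Re (h x x) + t * nsq x.
  by rewrite /h /quad !reimE -/(nsq x); ring.
have sV : lin_subspace (fdom fa) by have [] := hh.
have hc : qform_complete (fdom fa) h.
  move=> v Vv vc.
  have [x vx] : exists x : H, v @ \oo --> x.
    apply: hilbert_complete => e /vc[N hN]; exists N => n p Nn Np.
    by apply: le_lt_trans (hN _ _ Nn Np); apply: Qge; exact: lin_subspaceB.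
  have quadC y : fdom fa y -> quad fa y = (complex.Re (quad fa y))%:C.
    by move=> Vy; apply: herm_diag assoc_herm _ Vy.
  have [_ _ cl _ _] := hfa.
  (* [closed_form] speaks of [quad fa], which differs from [h] by [t * nsq]; the factor [1 + |t|]
     converts between the two. *)
  have t1 : 0 < 1 + `|t| by rewrite ltr_pwDl.
  have [e e0|Vx hx] := cl _ _ Vv vx.
    have [N hN] := vc _ (divr_gt0 e0 t1); exists N => n p Nn Np.
    have Vd := lin_subspaceB sV (Vv n) (Vv p).
    rewrite (quadC _ Vd) normc_def /= expr0n addr0 sqrtr_sqr ltcR QE.
    have := hN _ _ Nn Np; rewrite ltr_pdivlMr//; apply: le_lt_trans.
    apply: le_trans (ler_normD _ _) _; rewrite mulrDr mulr1.
    rewrite (ger0_norm (Q0 _ Vd)) lerD2l normrM (ger0_norm (nsq_ge0 _)) mulrC.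
    by rewrite ler_wpM2r//; exact: Qge.
  exists x => // e e0.
  have [N1 h1] := hx _ (divr_gt0 e0 (ltr0n _ 2)).
  have [N2 h2] := (cvg_nsq _ _).1 vx _ (divr_gt0 e0 (mulr_gt0 (ltr0n _ 2) t1)).
  exists (maxn N1 N2) => n; rewrite geq_max => /andP[/h1 {}h1 /h2 {}h2].
  have Vd := lin_subspaceB sV (Vv n) Vx.
  move: h1; rewrite (quadC _ Vd) normc_def /= expr0n addr0 sqrtr_sqr ltcR => h1.
  have n0 := nsq_ge0 (v n - x).
  have ht : - t * nsq (v n - x) <= `|t| * nsq (v n - x).
    by rewrite ler_wpM2r// -normrN ler_norm.
  have := QE (v n - x); have := ler_norm (complex.Re (quad fa (v n - x))).
  rewrite ltr_pdivlMr// in h1; rewrite ltr_pdivlMr ?mulr_gt0// in h2.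
  move: h1 h2 n0 ht.
  move: (nsq _) `|complex.Re (quad fa (v n - x))| (complex.Re (quad _ _)).
  by move: (complex.Re _) (`|t|) (t) => *; lra.
pose s := z - t%:C.
(* Moving [z - t] to the right turns the weak equation into [<(A - t) x, u> = l x]. Here [u] enters
   only through inner products of [H], so [l] is bounded for [h]. *)
pose l x := g x + s * inner x u.
have [u' Vu' hu'] : exists2 u', fdom fa u' & forall x, fdom fa x -> l x = h x u'.
  apply: (riesz hh Q0 hc
    (C := 2 * ((`|a| + b * (1 + `|t|)) + nsqc s * nsq u))).
  - by rewrite mulr_ge0// !addr_ge0// mulr_ge0 ?nsqc_ge0 ?nsq_ge0// addr_ge0.
  - by move=> c x y Vx Vy; rewrite /l gl// innerDl innerZl; ring.
  move=> x Vx; apply: le_trans (nsqcD_le _ _) _.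
  set q := complex.Re (h x x).
  have -> (v w : R) : 2 * (v + w) * q = 2 * (v * q + w * q) by ring.
  rewrite ler_pM2l// lerD//.
    apply: le_trans (gb _ Vx) _; rewrite QE -/q.
    have -> (v w : R) : (v + b * w) * q = v * q + b * (w * q) by ring.
    have aq : a * nsq x <= `|a| * q.
      apply: le_trans (_ : `|a| * nsq x <= _).
        by rewrite ler_wpM2r ?nsq_ge0 ?ler_norm.
      by rewrite ler_wpM2l//; exact: Qge.
    have tq : t * nsq x <= `|t| * q.
      apply: le_trans (_ : `|t| * nsq x <= _).
        by rewrite ler_wpM2r ?nsq_ge0 ?ler_norm.
      by rewrite ler_wpM2l//; exact: Qge.
    rewrite lerD// ler_wpM2l//.
    have -> (v : R) : (1 + v) * q = q + v * q by ring.
    by rewrite lerD2l.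
  rewrite nsqcM -mulrA ler_wpM2l ?nsqc_ge0//.
  apply: le_trans (inner_CS _ _) _; rewrite mulrC ler_wpM2l ?nsq_ge0//.
  exact: Qge.
suff uu : u = u'.
  rewrite -uu in Vu' hu'; split=> // x Vx.
  by have := hu' _ Vx; rewrite /l /h /s => /eqP; rewrite -subr_eq0 => /eqP e;
    apply/eqP; rewrite -subr_eq0 -[X in _ == X]oppr0 -e; apply/eqP; ring.
apply/eqP; rewrite -subr_eq0; apply/eqP/nsq_eq0.
have Ac y y' : A (y, y') -> (t + 1) * nsq y <= complex.Re (inner y' y).
  by rewrite /t subrK; exact: Am.
have [d dE] : exists d, d = u - u' by exists (u - u').
(* The test vector [(A - t)^-1 (u - u')] turns the difference of the equations for [u] and [u'] into
   [<d, d> = 0]. *)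
have [x] := sa_surj sA ltr01 Ac (u - u'); rewrite -dE => Ax.
have := hu' _ (assoc_dom Ax); rewrite /l /h (assoc_val Ax Vu') -(weak _ _ Ax).
rewrite !innerDl !innerZl /s => e.
suff : inner d d = 0 by rewrite /nsq => ->.
rewrite {2}dE innerBr; apply/eqP; rewrite subr_eq0; apply/eqP.
move: e; set p := inner d u; set q := inner d u'.
have -> : p + t%:C * inner x u - z * inner x u + (z - t%:C) * inner x u = p by ring.
by rewrite addrK.
Qed.

End AssociatedForm.

Section ClosureBelow.
Context (R : realType) (E : lmodType R[i]).
Context (h : E -> E -> R[i]) (hh : herm_on setT h).
Let Q x : R := complex.Re (h x x).
Hypothesis Q_ge0 : forall x, 0 <= Q x.

Lemma quadD_le x y : Q (x + y) <= 2 * (Q x + Q y).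
Proof. by have := quad_triangle hh Q_ge0 x 0 (- y); rewrite !opprK subr0 add0r. Qed.

Lemma quadN x : Q (- x) = Q x.
Proof. by rewrite -scaleN1r /Q (quadZ hh) /nsqc !reimE; ring. Qed.

Lemma closure_below (T0 : set (E * E)) (z : R[i]) (C : R) x y : 0 <= C ->
  (forall x y, T0 (x, y + z *: x) -> Q x <= C * Q y) ->
  (forall e : R, 0 < e -> exists x' y', [/\ T0 (x', y'), Q (x - x') < e
     & Q (y + z *: x - y') < e]) ->
  Q x <= 4 * C * Q y.
Proof.
move=> C0 T0C cl.
(* This collects the coefficients of the approximation error [d]; the factor 4 in the conclusion
   comes from splitting both [x'] and [y'] off by [quadD_le]. *)
pose K := 2 + 8 * C * (1 + nsqc z).
have K0 : 0 < K by rewrite ltr_pwDl// !mulr_ge0// addr_ge0 ?nsqc_ge0.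
apply/ler_addgt0Pr => e e0; have eK := divr_gt0 e0 K0.
have [x' [v [Tv xx vv]]] := cl _ eK; set d := e / K in eK xx vv.
pose y' := v - z *: x'.
have h1 : Q x' <= C * Q y' by apply: T0C; rewrite /y' subrK.
have h2 : Q x <= 2 * (Q (x - x') + Q x') by have := quadD_le (x - x') x'; rewrite subrK.
have h3 : Q y' <= 2 * (Q (y' - y) + Q y) by have := quadD_le (y' - y) y; rewrite subrK.
have h4 : Q (y' - y) <= 2 * (Q (y + z *: x - v) + nsqc z * Q (x - x')).
  rewrite -(quadZ hh) -(quadN (y + z *: x - v)).
  have -> : y' - y = - (y + z *: x - v) + z *: (x - x').
    by rewrite /y' scalerBr opprB opprD !addrA subrK addrAC.
  exact: quadD_le.
have := nsqc_ge0 z; have := Q_ge0 y.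
have -> : e = K * d by rewrite /d mulrC divfK// gt_eqF.
have h5 : nsqc z * Q (x - x') <= nsqc z * d by rewrite ler_wpM2l ?nsqc_ge0 ?ltW.
have h6 : Q y' <= 4 * (1 + nsqc z) * d + 2 * Q y by lra.
have h7 : C * Q y' <= C * (4 * (1 + nsqc z) * d + 2 * Q y) by rewrite ler_wpM2l.
rewrite /K; lra.
Qed.
End ClosureBelow.

(** * Hilbert structure of the orthogonal sum *)

Section Product.
Context (R : realType) (H1 H2 : hilbertType R).

Definition inner2 (x y : H1 * H2) : R[i] := inner x.1 y.1 + inner x.2 y.2.

Lemma Re_inner2 x : complex.Re (inner2 x x) = nsq x.1 + nsq x.2.
Proof. by rewrite /inner2 reimE. Qed.

Lemma inner2_herm : herm_on setT inner2.
Proof.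
split=> // [z _ c x y _ _|x y _ _].
  by rewrite /inner2 /= !innerDl !innerZl; ring.
by rewrite /inner2 rmorphD /= -!innerC.
Qed.

Lemma inner2_ge0 x : 0 <= complex.Re (inner2 x x).
Proof. by rewrite Re_inner2 addr_ge0 ?nsq_ge0. Qed.

Lemma inner2_eq0 x : complex.Re (inner2 x x) <= 0 -> x = 0.
Proof.
case: x => x1 x2; rewrite Re_inner2 /= => h.
have := nsq_ge0 x1; have := nsq_ge0 x2 => h2 h1.
have -> : x1 = 0 by apply: nsq_eq0; lra.
by have -> : x2 = 0 by apply: nsq_eq0; lra.
Qed.

Lemma inner2_complete : qform_complete setT inner2.
Proof.
move=> u _ uc.
have [x1 /cvg_nsq u1] : exists x : H1, (fun n => (u n).1) @ \oo --> x.
  apply: hilbert_complete => e /uc[N hN]; exists N => n m Nn Nm.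
  apply: le_lt_trans (hN _ _ Nn Nm); rewrite Re_inner2 lerDl nsq_ge0//.
have [x2 /cvg_nsq u2] : exists x : H2, (fun n => (u n).2) @ \oo --> x.
  apply: hilbert_complete => e /uc[N hN]; exists N => n m Nn Nm.
  apply: le_lt_trans (hN _ _ Nn Nm); rewrite Re_inner2 lerDr nsq_ge0//.
exists (x1, x2) => // e e0; have e2 := divr_gt0 e0 (ltr0n _ 2).
have [N1 h1] := u1 _ e2; have [N2 h2] := u2 _ e2.
exists (maxn N1 N2) => n; rewrite geq_max => /andP[/h1 {}h1 /h2 {}h2].
by rewrite Re_inner2 /= [e]splitr ltrD.
Qed.

Lemma norm_prod (x : H1 * H2) :
  `|x| = (Num.sqrt (Num.max (nsq x.1) (nsq x.2)))%:C.
Proof.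
have -> : `|x| = Num.max `|x.1| `|x.2| by [].
rewrite !norm_nsq /Order.max /Order.max ltcR.
have := nsq_ge0 x.1; have := nsq_ge0 x.2 => h2 h1.
case: (ltrP (nsq x.1) (nsq x.2)) => h.
  by rewrite ltr_sqrt ?h//; apply: le_lt_trans h.
by rewrite ltNge ler_wsqrtr.
Qed.

Lemma closure_inner2 (T : set ((H1 * H2) * (H1 * H2))) x y :
  closure T (x, y) <-> forall e : R, 0 < e -> exists x' y', [/\ T (x', y'),
    complex.Re (inner2 (x - x') (x - x')) < e
    & complex.Re (inner2 (y - y') (y - y')) < e].
Proof.
case: x y => [x1 x2] [y1 y2]; rewrite closure_graph2; split=> h e e0.
  have [a1 [a2 [b1 [b2 [Tab ha1 ha2 hb1 hb2]]]]] := h _ (divr_gt0 e0 (ltr0n _ 2)).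
  exists (a1, a2), (b1, b2); split=> //; rewrite Re_inner2 /= [e]splitr; exact: ltrD.
have [[a1 a2] [[b1 b2] [Tab]]] := h _ e0; rewrite !Re_inner2 /= => h1 h2.
have := nsq_ge0 (x1 - a1); have := nsq_ge0 (x2 - a2).
have := nsq_ge0 (y1 - b1); have := nsq_ge0 (y2 - b2) => *.
by exists a1, a2, b1, b2; split=> //; lra.
Qed.

End Product.

Section Adjoint.
Context (R : realType) (H K : hilbertType R) (B : set (H * K)).

Lemma adjoint_subspace : lin_subspace (adjoint B).
Proof.
split; first by move=> x y _; rewrite /= !inner0r.
move=> c [u u'] [v v'] hu hv x y Bxy /=.
by rewrite !innerDr !innerZr (hu _ _ Bxy) (hv _ _ Bxy).
Qed.

Lemma dense_orthogonal (S : set H) w : dense S ->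
  (forall y, S y -> inner y w = 0) -> w = 0.
Proof.
move=> dS h; apply: nsq_eq0; rewrite -[X in _ <= X](mulr0 16).
apply: (dense_norm dS) => // y /h; rewrite innerC => /(congr1 (@nsqc R)).
by rewrite mul0r /nsqc !reimE sqrrN => ->; rewrite expr0n addr0.
Qed.

Lemma adjoint_functional : densely_defined B -> functional_graph (adjoint B).
Proof.
move=> dB x y z hy hz; apply/eqP; rewrite -subr_eq0; apply/eqP.
apply: (dense_orthogonal dB) => u [v Buv].
by rewrite innerBr -(hy _ _ Buv) -(hz _ _ Buv) subrr.
Qed.

End Adjoint.

(** * The block operator *)

Section Block.
Context (R : realType) (H1 H2 : hilbertType R).
Context (A : set (H1 * H1)) (B : set (H2 * H1)) (D : set (H2 * H2)).
Context (fa : qform H1) (fd : qform H2) (a b : R).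
Hypothesis sA : selfadjoint A.
Hypothesis oB : is_operator B.
Hypothesis dB : densely_defined B.
Hypothesis sD : selfadjoint D.
Hypothesis hfa : associated_form A fa.
Hypothesis hfd : associated_form D fd.
Hypothesis faB : fdom fa `<=` dom (adjoint B).
Hypothesis domBD :
  (dom B `<=` dom D /\ is_core (dom B) D) \/ fdom fd `<=` dom B.
Hypothesis b0 : 0 <= b.
Hypothesis hB : forall x y, fdom fa x -> adjoint B (x, y) ->
  `|y| ^+ 2 <= a%:C * `|x| ^+ 2 + b%:C * quad fa x.

Variables (am dp dm : R) (db : bool).
Hypothesis Am : forall x x', A (x, x') -> am * nsq x <= complex.Re (inner x' x).
Hypothesis Dp : forall x x', D (x, x') -> complex.Re (inner x' x) <= dp * nsq x.
Hypothesis Dm : db ->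
  forall x x', D (x, x') -> dm * nsq x <= complex.Re (inner x' x).

Variable z : R[i].
Hypothesis norel : forall p q al de b1 b2, 0 < p + q ->
  ~ nr_relation a b am dp db dm (complex.Re z) (complex.Im z) p q al de b1 b2.

Let M0 := block_op A B D.

Lemma adjoint_bound x y : fdom fa x -> adjoint B (x, y) ->
  nsq y <= a * nsq x + b * complex.Re (quad fa x).
Proof.
move=> Vx /(hB Vx); rewrite !norm2_nsq lecE => /andP[_].
by rewrite !reimE !mul0r !subr0.
Qed.

Lemma operB_subspace : lin_subspace B.
Proof. by have [/submod_lin_subspace] := oB. Qed.

Lemma block_subspace : lin_subspace M0.
Proof.
have [A0 Al] := sa_subspace sA; have [D0 Dl] := sa_subspace sD.
have [B0 Bl] := operB_subspace; have [Bs0 Bsl] := adjoint_subspace B.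
split.
  by exists 0, 0, 0, 0; split=> //=; rewrite oppr0 !addr0.
move=> c p q [x1 [x2 [x3 [x4 [h1 h2 h3 h4 h5]]]]].
move=> [y1 [y2 [y3 [y4 [k1 k2 k3 k4 k5]]]]].
exists (c *: x1 + y1), (c *: x2 + y2), (c *: x3 + y3), (c *: x4 + y4).
split; [exact: Al h1 k1|exact: Bl h2 k2|exact: Bsl h3 k3|exact: Dl h4 k4|].
rewrite /= h5 k5; congr (_, _) => /=; first by rewrite scalerDr addrACA.
by rewrite scalerDr addrACA scalerN opprD.
Qed.

Lemma young (r s X Y e : R) : 0 < e -> 0 <= X -> 0 <= Y ->
  r ^+ 2 + s ^+ 2 <= X * Y -> `|r| + `|s| <= 2 * (e * Y + e^-1 * X).
Proof.
move=> e0 X0 Y0 h.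
have t0 : 0 <= e^-1 * X by rewrite mulr_ge0// invr_ge0 ltW.
have y0 : 0 <= e * Y by rewrite mulr_ge0// ltW.
have XY : X * Y = (e * Y) * (e^-1 * X) by field; rewrite gt_eqF.
have hh (t : R) : t ^+ 2 <= X * Y -> `|t| <= e * Y + e^-1 * X.
  rewrite XY -(real_normK (num_real t)); have := normr_ge0 t.
  move: `|t| (e * Y) (e^-1 * X) y0 t0 => u v w v0 w0 u0 le.
  rewrite leNgt; apply/negP => lt; nra.
have hr := hh r; have hs := hh s.
have := hr (le_trans (_ : _ <= r ^+ 2 + s ^+ 2) h).
have := hs (le_trans (_ : _ <= r ^+ 2 + s ^+ 2) h).
rewrite lerDl lerDr !sqr_ge0 => /(_ isT) + /(_ isT).
by move: `|r| `|s| (e * Y) (e^-1 * X) => *; lra.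
Qed.

(** The residuals in [nr_gap] are the real and imaginary parts of [<y1, x1>] and [<y2, x2>]. The
    conjugate of [be] in the second, due to the entry [- B*], gives [b1] opposite signs and [b2]
    equal signs in the two equations. *)
Lemma block_below : exists2 C : R, 0 <= C & forall x y,
  M0 (x, y + z *: x) ->
  complex.Re (inner2 x x) <= C * complex.Re (inner2 y y).
Proof.
have [c c0 gap] := nr_gap b0 norel.
exists (16 / c ^+ 2); first by rewrite divr_ge0// sqr_ge0.
move=> [x1 x2] [y1 y2] [Ax [By [Bx [Dy [/= hA hBy hBx hD]]]]].
case=> e1 e2; rewrite !Re_inner2 /=.
have Vx := assoc_dom hfa hA.
have qE : complex.Re (quad fa x1) = complex.Re (inner Ax x1).
  by rewrite /quad (assoc_val hfa hA).
have bnd := adjoint_bound Vx hBx; rewrite qE in bnd.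
have dual : inner By x1 = inner x2 Bx := hBx _ _ hBy.
set p := nsq x1; set q := nsq x2.
set be := inner By x1.
have f1 : inner y1 x1 = inner Ax x1 + be - z * p%:C.
  by rewrite /p -inner_nsq -innerZl /be -innerDl -innerBl -e1 addrK.
have f2 : inner y2 x2 = inner Dy x2 - be^* - z * q%:C.
  rewrite /q -inner_nsq -innerZl /be dual -innerC -innerBl -innerBl.
  by rewrite [Dy - Bx]addrC -e2 addrK.
have p0 : 0 <= p by exact: nsq_ge0.
have q0 : 0 <= q by exact: nsq_ge0.
have := gap p q (complex.Re (inner Ax x1)) (complex.Re (inner Dy x2))
  (complex.Re be) (complex.Im be).
have al0 : 0 <= a * p + b * complex.Re (inner Ax x1).
  exact: le_trans (nsq_ge0 _) bnd.
have be_le : complex.Re be ^+ 2 + complex.Im be ^+ 2 <=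
    (a * p + b * complex.Re (inner Ax x1)) * q.
  rewrite -/(nsqc be) /be dual; apply: le_trans (inner_CS _ _) _.
  by rewrite mulrC ler_wpM2r.
have ineqs : [/\ 0 <= p, 0 <= q, am * p <= complex.Re (inner Ax x1),
    complex.Re (inner Dy x2) <= dp * q
    & db -> dm * q <= complex.Re (inner Dy x2)].
  by split=> //; [exact: Am|exact: Dp|move=> d; exact: Dm].
move=> /(_ ineqs al0 be_le).
(* With this weight in [young], the residuals cost only [(c / 2) (p + q)], half of the left side;
   the remaining [(8 / c) |y|^2] gives the constant [16 / c^2]. *)
have c4 : 0 < c / 4 by rewrite divr_gt0.
have := young c4 (nsq_ge0 y1) p0 (inner_CS y1 x1).
have := young c4 (nsq_ge0 y2) q0 (inner_CS y2 x2).
have -> : complex.Re (inner y1 x1) =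
    complex.Re (inner Ax x1) + complex.Re be - complex.Re z * p.
  by rewrite f1 !reimE; ring.
have -> : complex.Im (inner y1 x1) = complex.Im be - complex.Im z * p.
  by rewrite f1 !reimE (sa_Im0 sA hA); ring.
have -> : complex.Re (inner y2 x2) =
    complex.Re (inner Dy x2) - complex.Re be - complex.Re z * q.
  by rewrite f2 !reimE; ring.
have -> : complex.Im (inner y2 x2) = complex.Im be - complex.Im z * q.
  by rewrite f2 !reimE (sa_Im0 sD hD); ring.
move: `|_| `|_| `|_| `|_| => t1 t2 t3 t4 h2 h1 h3.
have {h1 h2 h3} h : c * (p + q) <= 16 / c * (nsq y1 + nsq y2).
  have ci : (c / 4)^-1 = 4 / c by rewrite invf_div.
  by move: h1 h2 h3; rewrite ci; move: (c^-1) => d *; lra.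
have -> : 16 / c ^+ 2 = 16 / c / c by field; rewrite gt_eqF.
by rewrite mulrAC ler_pdivlMr// mulrC.
Qed.

Lemma orthogonal_zero (e : H1 * H2) :
  (forall x y, closure M0 (x, y + z *: x) -> inner2 y e = 0) -> e = 0.
Proof.
case: e => u w h.
have {}h x y : M0 (x, y) -> inner2 (y - z *: x) (u, w) = 0.
  by move=> Mxy; apply: (h x); rewrite subrK; exact: subset_closure.
have A0 : A (0, 0) := (sa_subspace sA).1.
have D0 : D (0, 0) := (sa_subspace sD).1.
have B0 : B (0, 0) := operB_subspace.1.
have Bs0 : adjoint B (0, 0) := (adjoint_subspace B).1.
have hx x Ax Bx : A (x, Ax) -> adjoint B (x, Bx) ->
    inner Ax u - z * inner x u = inner Bx w.
  move=> hA hBx; have := h (x, 0) (Ax, - Bx).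
  rewrite /inner2 /= scaler0 subr0 innerBl innerZl innerNl => hM.
  apply/eqP; rewrite -subr_eq0; apply/eqP; apply: hM.
  by exists Ax, 0, Bx, 0; split=> //=; rewrite !addr0.
have hy y By Dy : B (y, By) -> D (y, Dy) ->
    inner By u + inner Dy w - z * inner y w = 0.
  move=> hBy hD; have := h (0, y) (By, Dy).
  rewrite /inner2 /= scaler0 subr0 innerBl innerZl addrA; apply.
  by exists 0, By, 0, Dy; split=> //=; rewrite oppr0 !add0r.
have /choice[Bs hBs] : forall x, exists y, fdom fa x -> adjoint B (x, y).
  move=> x; have [Vx|nVx] := pselect (fdom fa x); last by exists 0.
  by have [y hy'] := faB Vx; exists y.
have sV : lin_subspace (fdom fa) by have [] := assoc_herm hfa.
have BsZ c x y : fdom fa x -> fdom fa y -> Bs (c *: x + y) = c *: Bs x + Bs y.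
  move=> Vx Vy; apply: (adjoint_functional dB (x := c *: x + y)).
    by apply: hBs; exact: sV.2.
  exact: (adjoint_subspace B).2 c (x, Bs x) (y, Bs y) (hBs _ Vx) (hBs _ Vy).
have Bs_le x : fdom fa x -> nsq (Bs x) <= a * nsq x + b * complex.Re (quad fa x).
  by move=> Vx; exact: adjoint_bound (hBs _ Vx).
have [Vu hu] : fdom fa u /\
    forall x, fdom fa x -> fval fa x u - z * inner x u = inner (Bs x) w.
  (* The functional is [<B* x, w>]; Cauchy-Schwarz multiplies the form bound on [B*] by [|w|^2]. *)
  apply: (assoc_weak sA hfa Am (a := nsq w * a) (b := nsq w * b)).
  - by move=> c x y Vx Vy; rewrite BsZ// innerDl innerZl.
  - by rewrite mulr_ge0// nsq_ge0.
  - move=> x Vx; apply: le_trans (inner_CS _ _) _.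
    by rewrite -!mulrA -mulrDr mulrC ler_wpM2l ?nsq_ge0// Bs_le.
  - move=> x x' Ax; apply: hx => //; apply: hBs; exact: assoc_dom Ax.
have dual y By : B (y, By) -> inner By u = inner y (Bs u).
  by move=> hBy; exact: (hBs _ Vu).
have weakD y Dy : dom B y -> D (y, Dy) -> inner Dy w = inner y (z^* *: w - Bs u).
  move=> [By hBy] hD; have := hy _ _ _ hBy hD; rewrite (dual _ _ hBy).
  rewrite innerBr innerZr conjCK => e; apply/eqP; rewrite -subr_eq0 -e.
  by apply/eqP; ring.
have Dw : D (w, z^* *: w - Bs u).
  (* Under (I) the weak identity on [dom B] extends to [dom D] along the core; under (II) [dom D]
     lies in the form domain, hence already in [dom B]. *)
  apply: (sa_max sD) => y Dy hD; case: domBD => [[_ [_ core]]|dB'].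
    apply/eqP; rewrite -subr_eq0; apply/eqP.
    set v := _ - Bs u in weakD *.
    apply: (@nsqc_small _ _ (2 * (nsq w + nsq v))).
      by rewrite mulr_ge0// addr_ge0 ?nsq_ge0.
    move=> e e0.
    have : closure (restrict_op D (dom B)) (y, Dy).
      by rewrite core; exact: subset_closure.
    move/closure_graph => /(_ e e0)[y' [Dy' [[hD' dy'] h1 h2]]].
    have -> : inner Dy w - inner y v = inner (Dy - Dy') w + inner (y' - y) v.
      by rewrite !innerBl (weakD _ _ dy' hD'); ring.
    apply: le_trans (nsqcD_le _ _) _; rewrite -mulrA ler_pM2l// mulrDl lerD//.
      apply: le_trans (inner_CS _ _) _; rewrite mulrC ler_wpM2l ?nsq_ge0//.
      exact: ltW.
    apply: le_trans (inner_CS _ _) _; rewrite mulrC ler_wpM2l ?nsq_ge0//.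
    by rewrite nsqBC ltW.
  by apply: weakD => //; apply: dB'; exact: assoc_dom hD.
have [e0|e0] := leP (nsq u + nsq w) 0.
  have := nsq_ge0 u; have := nsq_ge0 w => w0 u0.
  have -> : u = 0 by apply: nsq_eq0; lra.
  by have -> : w = 0 by apply: nsq_eq0; lra.
(* Although [w] satisfies an equation with [z^*], pairing [D w] with [w] on the left gives
   [b2 = z2 q], matching [b2 = z2 p] from the equation for [u]: the contradiction arises at [z]
   itself, not at its conjugate. *)
exfalso; pose be := - inner (Bs u) w.
apply: (@norel (nsq u) (nsq w) (complex.Re (quad fa u))
  (complex.Re (inner (z^* *: w - Bs u) w)) (complex.Re be) (complex.Im be)) => //.
have equ := hu _ Vu.
have qu : fval fa u u = (complex.Re (quad fa u))%:C.
  exact: (herm_diag (assoc_herm hfa) Vu).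
rewrite qu inner_nsq in equ.
have im0 := sa_Im0 sD Dw.
have eqw : inner (z^* *: w - Bs u) w = z^* * (nsq w)%:C + be.
  by rewrite innerBl innerZl inner_nsq.
split.
  split; rewrite ?nsq_ge0//; first exact: (assoc_lower sA hfa Am).
    exact: Dp.
  by move=> d; exact: Dm Dw.
split.
- exact: le_trans (nsq_ge0 _) (Bs_le _ Vu).
- rewrite -/(nsqc be) /be.
  have -> : nsqc (- inner (Bs u) w) = nsqc (inner (Bs u) w).
    by rewrite /nsqc !reimE !sqrrN.
  apply: le_trans (inner_CS _ _) _.
  by rewrite ler_wpM2r ?nsq_ge0// Bs_le.
- by rewrite /be -equ !reimE; ring.
- by rewrite eqw !reimE; ring.
- move: im0; rewrite eqw /be -equ !reimE => im0; split; last by lra.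
  by ring.
Qed.

Lemma closure_block_subspace : lin_subspace (closure M0).
Proof.
have [M00 Ml] := block_subspace.
split; first exact: subset_closure.
move=> c [x y] [x' y'] /closure_inner2 hp /closure_inner2 hq.
apply/closure_inner2 => e e0.
have c0 : 0 < 2 * (nsqc c + 1) by rewrite mulr_gt0// ltr_pwDr// nsqc_ge0.
have [u [v [Muv hu hv]]] := hp _ (divr_gt0 e0 c0).
have [u' [v' [Muv' hu' hv']]] := hq _ (divr_gt0 e0 c0).
exists (c *: u + u'), (c *: v + v').
have comb (s t s' t' : H1 * H2) :
    complex.Re (inner2 (s - t) (s - t)) < e / (2 * (nsqc c + 1)) ->
    complex.Re (inner2 (s' - t') (s' - t')) < e / (2 * (nsqc c + 1)) ->
    complex.Re (inner2 (c *: s + s' - (c *: t + t')) (c *: s + s' - (c *: t + t'))) < e.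
  move=> h1 h2.
  have -> : c *: s + s' - (c *: t + t') = c *: (s - t) + (s' - t').
    by rewrite scalerBr opprD addrACA.
  apply: le_lt_trans (quadD_le (inner2_herm H1 H2) (@inner2_ge0 _ _ _) _ _) _.
  rewrite (quadZ (inner2_herm H1 H2)).
  move: h1 h2; rewrite !ltr_pdivlMr//.
  have := nsqc_ge0 c; have := inner2_ge0 (s - t); have := inner2_ge0 (s' - t').
  by move: (complex.Re _) (complex.Re _) (nsqc c) => *; nra.
split; [exact: (Ml c (u, v) (u', v'))|exact: comb|exact: comb].
Qed.

Lemma block_resolvent : resolvent_set (closure M0) z.
Proof.
have [C C0 hC] := block_below.
have herm := inner2_herm H1 H2.
have sM := closure_block_subspace.
have below x y : closure M0 (x, y + z *: x) ->
    complex.Re (inner2 x x) <= 4 * C * complex.Re (inner2 y y).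
  move/closure_inner2 => h.
  exact: (closure_below herm (@inner2_ge0 _ _ _) C0 hC h).
have surj : forall y, exists x, closure M0 (x, y + z *: x).
  apply: (closed_range herm (@inner2_ge0 _ _ _) (@inner2_complete _ _ _) sM _ below).
    move=> x y h; rewrite (closure_id (closure M0)).1; last exact: closed_closure.
    exact: (closure_inner2 (closure M0) x y).2 h.
  exact: orthogonal_zero.
split=> [y|].
  have [x Mx] := surj y; exists x; split=> // x' Mx'.
  exact: (resolvent_inj herm (@inner2_eq0 _ _ _) sM below Mx Mx').
(* Twice the constant [4 * C] of [below], since a sum of two squares is at most twice their
   maximum. *)
exists (Num.sqrt (8 * C)) => x y /below; rewrite !Re_inner2 => h.
rewrite !norm_prod -rmorphM lecR /= -sqrtrM ?mulr_ge0//; apply: ler_wsqrtr.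
have := nsq_ge0 x.1; have := nsq_ge0 x.2 => x2 x1.
have y1 : nsq y.1 <= Num.max (nsq y.1) (nsq y.2) by rewrite le_max lexx.
have y2 : nsq y.2 <= Num.max (nsq y.1) (nsq y.2) by rewrite le_max lexx orbT.
have xx : Num.max (nsq x.1) (nsq x.2) <= nsq x.1 + nsq x.2.
  by rewrite ge_max lerDl lerDr x1 x2.
apply: le_trans xx _; apply: le_trans h _.
apply: le_trans (_ : 4 * C * (Num.max (nsq y.1) (nsq y.2) *+ 2) <= _).
  by rewrite ler_wpM2l ?mulr_ge0// mulr2n lerD.
by rewrite le_eqVlt; apply/orP; left; apply/eqP; ring.
Qed.

End Block.

Lemma bounded_form_below (R : realType) (H : hilbertType R) (T : set (H * H)) :
  selfadjoint T -> bounded_op T -> form_bounded_below T.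
Proof.
move=> sT [C hC]; exists (- `|C|) => x y Txy.
rewrite norm2_nsq -rmorphM lecE (sa_Im0 sT Txy) eqxx /=.
have : nsq (- y) <= `|C| ^+ 2 * nsq x.
  by rewrite nsqN real_normK ?num_real//; exact: nsq_le_norm (hC _ _ Txy).
move/(Re_inner_le (normr_ge0 C)); rewrite innerNl reimE; lra.
Qed.

Theorem theorem4p13 (R : realType) (H1 H2 : hilbertType R)
  (A : set (H1 * H1)) (B : set (H2 * H1)) (D : set (H2 * H2))
  (fa : qform H1) (fd : qform H2) (a b : R) :
  (exists x : H1, x != 0) ->
  (exists x : H2, x != 0) ->
  selfadjoint A -> form_bounded_below A ->
  is_operator B -> densely_defined B -> closable B ->
  selfadjoint D -> form_bounded_above D ->
  associated_form A fa ->
  associated_form D fd ->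
  fdom fa `<=` dom (adjoint B) ->
  (dom B `<=` dom D /\ is_core (dom B) D) \/ fdom fd `<=` dom B ->
  0 <= b ->
  (forall x y, fdom fa x -> adjoint B (x, y) ->
     `|y| ^+ 2 <= a%:C * `|x| ^+ 2 + b%:C * quad fa x) ->
  let M := closure (block_op A B D) in
  spectrum M `<=` BB A D a b /\
  (condA A D a b -> spectrum M `<=` range (real_complex R)).
Proof.
move=> H1n H2n sA A_below oB dB _ sD D_above hfa hfd faB domBD b0 hB M.
have [_ [_ Am]] := sa_spectrum_min sA H1n A_below.
have Dp := sa_spectrum_max sD H2n D_above.
have Dm : `[< bounded_op D >] -> forall x x', D (x, x') ->
    set_min (real_spectrum D) * nsq x <= complex.Re (inner x' x).
  move=> /asboolP bD; have := bounded_form_below sD bD.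
  by move/(sa_spectrum_min sD H2n) => [_ []].
have incl : spectrum M `<=` BB A D a b.
  move=> z; apply: contra_notP => nBB.
  apply: (block_resolvent sA oB dB sD hfa hfd faB domBD b0 hB Am Dp Dm).
  by move=> p q al de b1 b2 pq rel; apply: nBB; exact: nr_relation_BB rel.
split=> // cA z /incl; rewrite /BB cA.
by case: ifP => _ [t _ <-]; exists t.
Qed.
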